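(* For $p\in[1,\infty]$ define $\tau$ by $\frac1\tau=1+\frac1p$ (with $\frac1\infty=0$). Let $\mathcal{M}$ be the class of all smooth, radial, nonnegative functions $\varphi:\mathbb{R}^2\to\mathbb{R}$ supported in the unit ball, such that $\int_{\mathbb{R}^2}\varphi=1$ and such that $\varphi(x)$ decreases (in the sense of being nonincreasing) as $|x|$ increases. (i) If $p\ge2$, then every $\varphi\in\mathcal{M}$ satisfies $$C_{p,\varphi}\ \ge\ \frac2\pi\left(\frac{4}{\tau+2}\right)^{\frac1\tau},$$ and this lower bound is optimal, i.e. the right-hand side equals $\inf_{\varphi\in\mathcal{M}}C_{p,\varphi}$. (ii) If $p<2$, there is no such bound, i.e. there is no constant $c>0$ such that $C_{p,\varphi}\ge c$ for all $\varphi\in\mathcal{M}$.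
   Context: For a function $\varphi$ on $\mathbb{R}^2$ as in the claim, define $$\Phi(x):=\int_{\mathbb{R}}\varphi(x,y)\,dy\quad(x\in\mathbb{R}),\qquad C_{p,\varphi}:=\left\|\sqrt{|\Phi\,\Phi'|}\right\|_{L^\tau(\mathbb{R})}=\left(\int_{\mathbb{R}}|\Phi(x)\Phi'(x)|^{\tau/2}\,dx\right)^{1/\tau}.$$ *)

(* Defs.v *)
From HB Require Import structures.
From mathcomp Require Import all_boot all_order all_algebra.
From mathcomp Require Import all_classical all_reals all_analysis.

Set Implicit Arguments.
Unset Strict Implicit.
Unset Printing Implicit Defensive.

Import Order.TTheory GRing.Theory Num.Theory.
Import numFieldNormedType.Exports.

Local Open Scope classical_set_scope.
Local Open Scope ring_scope.

(* 1 / tau = 1 + 1 / p for p in [1, +oo]; the inverse in \bar R satisfies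
   +oo^-1 = 0, and [fine] is harmless because 1 + p^-1 lies in [1, 2]. *)
Definition tau (R : realType) (p : \bar R) : R := fine ((1 + p^-1)^-1)%E.

Lemma inv_tau (R : realType) (p : \bar R) :
  (1 <= p)%E -> ((tau p)^-1)%:E = (1 + p^-1)%E.
Proof.
move=> p1; rewrite /tau; case: p p1 => [r|_|//].
- rewrite lee_fin => r1; have r0 : 0 < r by exact: lt_le_trans r1.
  have s0 : 1 + r^-1 != 0 by rewrite gt_eqF// addr_gt0// invr_gt0.
  by rewrite inver gt_eqF// -EFinD inver (negbTE s0)/= invrK.
- by rewrite invey adde0 inver oner_eq0/= invr1 invr1.
Qed.

(* The norm of the library on R * R is the sup norm, hence this definition. *)
Definition enorm (R : realType) (z : R * R) : R :=
  Num.sqrt (z.1 ^+ 2 + z.2 ^+ 2).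

(* [Ck n f]: all partial derivatives of f of order <= n exist and are
   continuous. *)
Fixpoint Ck (R : realType) (n : nat) (f : R * R -> R) : Prop :=
  continuous f /\
  if n is m.+1 then
    [/\ forall z, derivable f z (1, 0), forall z, derivable f z (0, 1),
        Ck m ('D_(1, 0) f) & Ck m ('D_(0, 1) f)]
  else True.

Definition smooth (R : realType) (f : R * R -> R) : Prop := forall n, Ck n f.

Definition radial (R : realType) (f : R * R -> R) : Prop :=
  forall z w, enorm z = enorm w -> f z = f w.

Definition radially_nonincreasing (R : realType) (f : R * R -> R) : Prop :=
  forall z w, enorm z <= enorm w -> f w <= f z.

Definition mollifier (R : realType) : set (R * R -> R) :=
  [set phi | [/\ smooth phi, radial phi & forall z, 0 <= phi z] /\
     [/\ closure [set z | phi z != 0] `<=` [set z | enorm z <= 1],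
         (\int[@lebesgue_measure R \x @lebesgue_measure R]_z
            (phi z)%:E = 1)%E
       & radially_nonincreasing phi]].
Arguments mollifier : clear implicits.

Definition marginal (R : realType) (phi : R * R -> R) (x : R) : R :=
  \int[@lebesgue_measure R]_y phi (x, y).

Definition Cconst (R : realType) (p : \bar R) (phi : R * R -> R) : \bar R :=
  ('N[@lebesgue_measure R]_((tau p)%:E)[EFin \o
     (fun x => Num.sqrt `|marginal phi x * derive1 (marginal phi) x|)%R])%E.

(* Main.v *)
Require Import Defs.
From HB Require Import structures.
From mathcomp Require Import all_boot all_order all_algebra.
From mathcomp Require Import all_classical all_reals all_analysis.
From mathcomp Require Import measurable_realfun.
From mathcomp Require Import ring lra.
Import Order.TTheory GRing.Theory Num.Theory.
Import numFieldNormedType.Exports.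
Local Open Scope classical_set_scope.
Local Open Scope ring_scope.

(** Write [Phi] for the marginal of [phi], [s = tau / 2], and
    [I = \int |Phi Phi'|^s], so that the constant is [I^(1 / tau)].

    Lower bound.  For [x > 0] let [q y = - D_(1,0) phi (x, y) >= 0].  Its
    integral over the line is [- Phi' x].  As the gradient of a radial function
    is radial, [y q y = - x D_(0,1) phi (x, y)], so that integration by parts
    turns the moments of [q] of orders 1 and 2 into [phi (x, 0)] and [Phi x].
    The Cauchy-Schwarz inequality for the weight [q] then reads
    [- Phi Phi' >= 4 x phi(x, 0)^2] ([marginal_dmarginal_ge]), with equality in
    the limit where [phi] is the normalized indicator of a ball.  It remains to
    minimize [\int_0^1 x^s f^tau] over the nonincreasing [f = pi phi(., 0)].
    The constraint [\int phi = 1] becomes [\int_0^1 2 x f = 1]: this is the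
    formula of polar coordinates, obtained here from the decomposition of [phi]
    into indicators of balls ([integral_radial]).  The integrand [x^s f^tau] is
    concave in [f], so that the minimum is attained at an indicator, and for
    [tau >= 2 / 3] the best radius is the largest one.  This is proved with an
    explicit function of [x] and of [F x = \int_0^x 2 u f u] whose derivative is
    at most the integrand ([integral_powR_profile]).

    Upper bounds.  The power [u |-> u^s] is below its tangents
    ([powR_tangent]), and [- 2 Phi Phi'] is the derivative of [- Phi^2]; hence
    [I] is controlled by [Phi^2] alone, without any estimate on [Phi'].  For
    the optimality of the bound, take [phi] close to the normalized indicator
    of the unit disk: then [Phi^2] is uniformly close to
    [4 / pi^2 (1 - x^2)] and [I] is almost the extremal value
    ([integral_powR_le_linear]).  For [tau < 2 / 3], let [phi] be concentrated
    in a disk of radius [b]: then [I] is at most a multiple of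
    [b^(1 - 3 s)], which tends to 0 with [b] ([integral_powR_le_const]).
    Both families come from [concentrated_mollifier], which is built from
    [exp (- 1 / u)]. *)

Set Implicit Arguments.
Unset Strict Implicit.
Unset Printing Implicit Defensive.

(** * Calculus on an interval *)

Lemma is_derive1_continuous (R : realType) (f : R -> R) (x d : R) :
  is_derive x 1 f d -> {for x, continuous f}.
Proof.
by move=> df; apply: differentiable_continuous; apply/derivable1_diffP.
Qed.

Lemma integral_is_derive (R : realType) (F f : R -> R) (a b : R) : a <= b ->
  {in `[a, b], forall x : R, is_derive x 1 F (f x)} ->
  {within `[a, b], continuous f} ->
  (\int[@lebesgue_measure R]_(x in `[a, b]) (f x)%:E = (F b - F a)%:E)%E.
Proof.
rewrite le_eqVlt => /predU1P[<- _ _|ab dF cf].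
  by rewrite set_itv1 integral_set1 subrr.
have cF x : a <= x <= b -> {for x, continuous F}.
  by move=> xab; have := dF x; rewrite in_itv/= xab => /(_ isT); exact: is_derive1_continuous.
rewrite (continuous_FTC2 (F := F))//.
- split.
  + move=> x; rewrite in_itv/= => /andP[ax xb].
    by have [] := dF x; rewrite ?in_itv/= ?ltW.
  + by apply: cvg_at_right_filter; apply: cF; rewrite lexx ltW.
  + by apply: cvg_at_left_filter; apply: cF; rewrite lexx ltW.
- move=> x; rewrite in_itv/= => /andP[ax xb].
  by rewrite derive1E; have [|] := dF x; rewrite ?in_itv/= ?ltW.
Qed.

Lemma is_derive_ge0_le (R : realType) (F f : R -> R) (a b : R) : a <= b ->
  {in `[a, b], forall x : R, is_derive x 1 F (f x)} ->
  (forall x, a < x < b -> 0 <= f x) -> F a <= F b.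
Proof.
move=> ab dF f0.
apply: (@ger0_derive1_ndecr _ F a b) => //.
- move=> x; rewrite in_itv/= => /andP[ax xb].
  by have [] := dF x; rewrite ?in_itv/= ?ltW.
- move=> x; rewrite in_itv/= => /andP[ax xb].
  rewrite derive1E; have [|_ ->] := dF x; first by rewrite in_itv/= !ltW.
  by apply: f0; rewrite ax xb.
- apply: continuous_in_subspaceT => x; rewrite inE/= => xab.
  exact: is_derive1_continuous (dF x xab).
Qed.

Lemma continuous_emeasurable (R : realType) (f : R -> R) (D : set R) :
  continuous f -> measurable_fun D (fun x => (f x)%:E).
Proof.
move=> cf; apply/measurable_EFinP; apply: measurable_funTS.
exact: continuous_measurable_fun.
Qed.

Lemma continuous_itv_integrable (R : realType) (f : R -> R) (a b : R) :
  continuous f -> (@lebesgue_measure R).-integrable `[a, b] (EFin \o f).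
Proof.
move=> cf; apply: continuous_compact_integrable; first exact: segment_compact.
exact: continuous_subspaceT.
Qed.

Lemma Rintegral_even (R : realType) (f : R -> R) (a : R) : 0 <= a ->
  continuous f -> (forall x, f (- x) = f x) ->
  \int[@lebesgue_measure R]_(x in `[- a, a]) f x =
  2 * \int[@lebesgue_measure R]_(x in `[0, a]) f x.
Proof.
move=> a0 cf fN; have int_f u v := @continuous_itv_integrable R f u v cf.
have E : \int[@lebesgue_measure R]_(x in `[- a, 0]) f x =
    \int[@lebesgue_measure R]_(x in `[0, a]) f x.
  rewrite /Rintegral -[X in `[_, X]]oppr0 integration_by_substitution_oppr//; last first.
    exact: continuous_subspaceT.
  by congr fine; apply: eq_integral => x _ /=; rewrite fN.
have S := @Rintegral_itvB R f (BLeft (- a)) (BRight a) 0 (int_f _ _).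
rewrite E Rintegral_itv_obnd_cbnd in S; last first.
  by apply: integrableS (int_f 0 a) => //; exact: subset_itv_oc_cc.
by rewrite mulr_natl mulr2n -[X in _ + X]S ?subrKC// bnd_simp// oppr_le0.
Qed.

Lemma RintegralB_continuous (R : realType) (f g : R -> R) (a b : R) :
  continuous f -> continuous g ->
  \int[@lebesgue_measure R]_(x in `[a, b]) (f x - g x) =
  \int[@lebesgue_measure R]_(x in `[a, b]) f x -
  \int[@lebesgue_measure R]_(x in `[a, b]) g x.
Proof. by move=> cf cg; apply: RintegralB => //; exact: continuous_itv_integrable. Qed.

Lemma RintegralZl_continuous (R : realType) (f : R -> R) (k a b : R) :
  continuous f ->
  \int[@lebesgue_measure R]_(x in `[a, b]) (k * f x) =
  k * \int[@lebesgue_measure R]_(x in `[a, b]) f x.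
Proof. by move=> cf; apply: RintegralZl => //; exact: continuous_itv_integrable. Qed.

(** The larger function need not be integrable: when its integral is infinite there
    is nothing to prove. *)
Lemma le_integral_continuous (R : realType) (g w : R -> R) (a b : R) :
  {within `[a, b], continuous g} -> measurable_fun setT w ->
  (forall x, 0 <= w x) -> {in `[a, b], forall x, g x <= w x} ->
  (\int[@lebesgue_measure R]_(x in `[a, b]) (g x)%:E <=
   \int[@lebesgue_measure R]_(x in `[a, b]) (w x)%:E)%E.
Proof.
move=> cg mw w0 gw.
have [->|fin] := eqVneq (\int[@lebesgue_measure R]_(x in `[a, b]) (w x)%:E)%E +oo%E.
  exact: leey.
apply: le_integral => //.
- by apply: continuous_compact_integrable => //; exact: segment_compact.
- apply/integrableP; split; first by apply/measurable_EFinP; exact: measurable_funTS.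
  under eq_integral do rewrite /= ger0_norm//.
  by rewrite lt_neqAle fin leey.
- by move=> x; rewrite inE/= => xab; rewrite lee_fin gw.
Qed.

Lemma antiderivative (R : realType) (g : R -> R) : continuous g ->
  exists F : R -> R, F 0 = 0 /\ {in `[0, 1], forall x : R, is_derive x 1 F (g x)}.
Proof.
move=> cg; pose G x := \int[@lebesgue_measure R]_(t in `[-1, x]) g t.
(* Integrating from -1 makes 0 an interior point, so that the derivative at 0 is
   two-sided. *)
exists (fun x => G x - G 0); split; first by rewrite subrr.
move=> x; rewrite in_itv/= => /andP[x0 x1].
have [] := @continuous_FTC1_closed R g (-1) x 2 _ (continuous_itv_integrable _ _ cg) _ (cg x).
- lra.
- lra.
- move=> dG GE; rewrite -[g x]subr0; apply: is_deriveB.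
  by rewrite -GE derive1E; exact: derivableP.
Qed.

Lemma integral_le_increment (R : realType) (f Q dQ : R -> R) (a b : R) : a <= b ->
  {in `[a, b], forall x : R, is_derive x 1 Q (dQ x)} ->
  {within `[a, b], continuous dQ} -> measurable_fun setT f ->
  (forall x, 0 <= f x) -> {in `[a, b], forall x, f x <= dQ x} ->
  (\int[@lebesgue_measure R]_(x in `[a, b]) (f x)%:E <= (Q b - Q a)%:E)%E.
Proof.
move=> ab dQE cdQ mf f0 fQ.
rewrite -(integral_is_derive ab dQE cdQ).
apply: ge0_le_integral => //.
- by move=> x _; rewrite lee_fin.
- by apply/measurable_EFinP; exact: measurable_funTS.
- apply/measurable_EFinP; exact: subspace_continuous_measurable_fun.
Qed.

(** * Areas of disks and polar coordinates *)

Lemma lebesgue_sqr_lt (R : realType) (c : R) :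
  (@lebesgue_measure R) [set y | y ^+ 2 < c] = (2 * Num.sqrt c)%:E.
Proof.
have -> : [set y | y ^+ 2 < c] = `](- Num.sqrt c), (Num.sqrt c)[%classic.
  apply/seteqP; split=> y /=; rewrite in_itv/= -ltr_norml.
    by move=> yc; rewrite -sqrtr_sqr ltr_sqrt// (le_lt_trans _ yc)// sqr_ge0.
  move=> yc; have c0 : 0 < c by rewrite -sqrtr_gt0 (le_lt_trans _ yc).
  by rewrite -(sqr_sqrtr (ltW c0)) -[ltLHS]real_normK ?num_real// ltr_pXn2r ?nnegrE.
rewrite lebesgue_measure_itv/= lte_fin; case: ltP => [|c0].
  by move=> _; rewrite -EFinD; congr EFin; ring.
have -> : Num.sqrt c = 0 by have := sqrtr_ge0 c; lra.
by rewrite mulr0.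
Qed.

(** The substitution [x = r sin t] avoids the endpoints, where the square root is
    not differentiable. *)
Lemma integral_half_circle (R : realType) (r : R) : 0 < r ->
  (\int[@lebesgue_measure R]_(x in `[(- r)%R, r]) (Num.sqrt (r ^+ 2 - x ^+ 2)%R)%:E =
    (pi * r ^+ 2 / 2)%:E)%E.
Proof.
move=> r0; have p0 : 0 < pi / 2 :> R by rewrite divr_gt0 ?pi_gt0.
pose S (x : R) : R := r * sin x.
have dS (x : R) : is_derive x 1 S (r * cos x).
  by rewrite /S; apply: is_derive_eq.
have S' : derive1 S = (fun x => r * cos x).
  by apply/funext => x; rewrite derive1E; have [] := dS x.
have crc : continuous (fun x => r * cos x).
  by move=> x; apply: cvgM; [exact: cvg_cst|exact: continuous_cos].
have cS : continuous S by move=> x; exact: is_derive1_continuous (dS x).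
have cs : continuous (fun x : R => Num.sqrt (r ^+ 2 - x ^+ 2)).
  move=> x; apply: (@continuous_comp _ _ _ (fun x : R => r ^+ 2 - x ^+ 2) Num.sqrt).
    by apply: cvgB; [exact: cvg_cst|exact: exprn_continuous].
  exact: sqrt_continuous.
have -> : `[- r, r]%classic = `[S (- (pi / 2)), S (pi / 2)]%classic.
  by rewrite /S sinN sin_pihalf mulrN mulr1.
rewrite integration_by_substitution_increasing; last 7 first.
- lra.
- by move=> x y x1 y1 xy; rewrite /S ltr_pM2l// ltr_sin.
- by rewrite S' => x _; exact: crc.
- by rewrite S'; apply/cvg_ex; eexists; apply: cvg_at_right_filter; exact: crc.
- by rewrite S'; apply/cvg_ex; eexists; apply: cvg_at_left_filter; exact: crc.
- split.
  + by move=> x _; have [] := dS x.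
  + by apply: cvg_at_right_filter; exact: cS.
  + by apply: cvg_at_left_filter; exact: cS.
- exact: continuous_subspaceT.
rewrite S'; transitivity
    (\int[@lebesgue_measure R]_(x in `[(- (pi / 2))%R, (pi / 2)%R])
      (r * cos x * (r * cos x))%:E)%E.
  apply: eq_integral => x; rewrite inE/= in_itv/= => xp.
  congr (EFin (_ * _)); rewrite /= /S exprMn -[X in X - _]mulr1 -mulrBr -cos2sin2.
  rewrite -exprMn sqrtr_sqr ger0_norm//.
  by rewrite mulr_ge0 ?(ltW r0)// cos_ge0_pihalf.
rewrite (integral_is_derive (F := fun x => r ^+ 2 * (x + sin x * cos x) / 2)).
- rewrite cosN sinN cos_pihalf !mulr0 !addr0; congr EFin; lra.
- lra.
- move=> x _; apply: is_derive_eq.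
  rewrite /GRing.scale/=.
  by rewrite -[X in (X + (_ * - _ + _))](cos2Dsin2 x); field.
- by apply: continuous_subspaceT => x; apply: cvgM; exact: crc.
Qed.

(** The square root of a negative number is 0, so that the integrand is the length
    of the chord of the disk at abscissa [x], for every [x]. *)
Lemma integral_chord (R : realType) (r : R) : 0 < r ->
  (\int[@lebesgue_measure R]_x (2 * Num.sqrt (r ^+ 2 - x ^+ 2)%R)%:E =
    (pi * r ^+ 2)%:E)%E.
Proof.
move=> r0; have h := integral_half_circle r0.
have mS : measurable_fun setT (fun x : R => Num.sqrt (r ^+ 2 - x ^+ 2)).
  apply: continuous_measurable_fun => x.
  apply: (@continuous_comp _ _ _ (fun x : R => r ^+ 2 - x ^+ 2) Num.sqrt).
    by apply: cvgB; [exact: cvg_cst|exact: exprn_continuous].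
  exact: sqrt_continuous.
under eq_integral do rewrite EFinM.
rewrite ge0_integralZl//=; last exact/measurable_EFinP.
transitivity (2%:E * (pi * r ^+ 2 / 2)%:E)%E; last by rewrite -EFinM; congr EFin; field.
congr (_ * _)%E; rewrite -h [RHS]integral_mkcond; apply: eq_integral => x _.
rewrite patchE; case: ifPn => //.
rewrite notin_setE/= in_itv/= -ler_norml => /negP; rewrite -ltNge => xr.
rewrite ler0_sqrtr// subr_le0 -[leRHS]real_normK ?num_real// ler_pXn2r ?nnegrE ?(ltW r0)//.
exact: ltW.
Qed.

Lemma disk_area (R : realType) (r : R) : 0 < r ->
  (@lebesgue_measure R \x @lebesgue_measure R)%E
    [set z | z.1 ^+ 2 + z.2 ^+ 2 < r ^+ 2] = (pi * r ^+ 2)%:E.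
Proof.
move=> r0; rewrite -(integral_chord r0); apply: eq_integral => x _ /=.
rewrite -lebesgue_sqr_lt; congr (lebesgue_measure _).
by apply/seteqP; split=> y; rewrite /xsection/= inE/= ltrBrDl.
Qed.

(** Write [h (sqrt t) = - \int_(sqrt t)^1 h'] and let the indicator carry the lower
    endpoint. The condition [sqrt t < r] is written [t < r ^+ 2] so that it is
    polynomial in the coordinates when [t] is a squared norm. *)
Lemma layer_cake_profile (R : realType) (h dh : R -> R) (t : R) :
  {in `[0, 1], forall x : R, is_derive x 1 h (dh x)} -> continuous dh ->
  (forall r, 1 <= r -> h r = 0) -> 0 <= t ->
  (h (Num.sqrt t))%:E =
  (\int[@lebesgue_measure R]_r
    ((- dh r * \1_(`[0, 1]) r) * (t < r ^+ 2)%R%:R)%:E)%E.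
Proof.
move=> dhE cdh h1 t0.
have s0 := sqrtr_ge0 t; set s := Num.sqrt t in s0 *.
have tE r : 0 <= r -> (t < r ^+ 2) = (s < r).
  by move=> r0; rewrite /s -[in LHS](sqr_sqrtr t0) ltr_pXn2r ?nnegrE.
have [s1|s1] := leP 1 s.
  rewrite h1// integral0_eq// => r _; rewrite indicE mem_setE in_itv/=.
  case: (boolP (0 <= r <= 1)); rewrite ?mulr0 ?mul0r// => /andP[r0 r1].
  by rewrite tE// ltNge (le_trans r1 s1) mulr0.
transitivity (\int[@lebesgue_measure R]_(r in `[s, 1%R]) (- dh r)%:E)%E.
  rewrite (integral_is_derive (F := fun r => - h r)).
  - by rewrite /= (h1 1)// oppr0 opprK add0r.
  - exact: ltW.
  - move=> x /[!in_itv]/= /andP[sx x1]; apply: is_deriveN; apply: dhE.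
    by rewrite in_itv/= x1 (le_trans s0 sx).
  - by apply: continuous_subspaceT => x; apply: cvgN; exact: cdh.
rewrite -integral_itv_obnd_cbnd; last first.
  apply: (@continuous_emeasurable _ (fun r => - dh r)) => x.
  by apply: cvgN; exact: cdh.
rewrite integral_mkcond; apply: eq_integral => r _.
rewrite patchE indicE !mem_setE !in_itv/=.
have [r0|r0] := leP 0 r; last first.
  by rewrite ltNge (le_trans (ltW r0) s0)/= mulr0 mul0r.
rewrite tE//=; case: (leP r 1) => r1; rewrite ?andbF ?andbT /=.
  by case: ltP => sr; rewrite ?mulr1 ?mulr0.
by rewrite mulr0 mul0r.
Qed.

(** Layer cake: a radial function is a superposition of indicators of disks, and
    the disk of radius [r] has area [pi r ^+ 2]. Tonelli's theorem is applied
    twice, once in each coordinate, the intermediate quantity being the length of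
    a chord. An integration by parts on the right-hand side would give the usual
    formula of polar coordinates. *)
Lemma integral_radial (R : realType) (h dh : R -> R) :
  {in `[0, 1], forall x : R, is_derive x 1 h (dh x)} -> continuous dh ->
  {in `[0, 1], forall r, dh r <= 0} ->
  continuous h -> (forall r, 0 <= h r) -> (forall r, 1 <= r -> h r = 0) ->
  (\int[@lebesgue_measure R \x @lebesgue_measure R]_z (h (enorm z))%:E =
   \int[@lebesgue_measure R]_(r in `[0%R, 1%R]) (- dh r * (pi * r ^+ 2))%:E)%E.
Proof.
move=> dhE cdh dh0 ch h0 h1.
pose g (r : R) := - dh r * \1_(`[0, 1]%classic : set R) r.
have g0 r : 0 <= g r.
  rewrite /g indicE mem_setE; case: (boolP (r \in _)); rewrite ?mulr0// mulr1 => /dh0.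
  by rewrite oppr_ge0.
have mg : measurable_fun setT g.
  apply: measurable_funM => //.
  apply: (@continuous_measurable_fun _ (fun r => - dh r)) => x.
  by apply: cvgN; exact: cdh.
pose T := measurableTypeR R.
have msq (f : T * T -> R) : measurable_fun setT f ->
    measurable_fun setT (fun z => f z ^+ 2).
  by move=> mf; apply: measurable_funX.
have msqrt : measurable_fun setT (Num.sqrt : R -> R).
  by apply: continuous_measurable_fun; exact: sqrt_continuous.
have mbool : measurable_fun setT (fun b : bool => b%:R : R) by [].
rewrite fubini_tonelli1; last 2 first.
- apply/measurable_EFinP; apply: (measurableT_comp (f := h)).
    exact: continuous_measurable_fun.
  have msum : measurable_fun setT (fun z : T * T => z.1 ^+ 2 + z.2 ^+ 2 : R).
    by apply: measurable_funD; exact: msq.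
  exact: measurableT_comp msqrt msum.
- by move=> z; rewrite lee_fin.
transitivity (\int[@lebesgue_measure R]_x \int[@lebesgue_measure R]_r
    (g r * (2 * Num.sqrt (r ^+ 2 - x ^+ 2)))%:E)%E.
  apply: eq_integral => x _; rewrite /fubini_F.
  transitivity (\int[@lebesgue_measure R]_y \int[@lebesgue_measure R]_r
      (g r * (x ^+ 2 + y ^+ 2 < r ^+ 2)%R%:R)%:E)%E.
    apply: eq_integral => y _; rewrite /enorm /= (layer_cake_profile dhE)//.
    by rewrite addr_ge0// sqr_ge0.
  rewrite (@fubini_tonelli _ _ T T R lebesgue_measure lebesgue_measure
     (fun z => (g z.2 * (x ^+ 2 + z.1 ^+ 2 < z.2 ^+ 2)%R%:R)%:E))/=; last 2 first.
  - apply/measurable_EFinP; apply: measurable_funM.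
      exact: measurableT_comp mg _.
    apply: (measurableT_comp mbool).
    apply: measurable_fun_ltr; last exact: msq.
    by apply: measurable_funD => //; exact: msq.
  - by move=> z; rewrite lee_fin mulr_ge0.
  apply: eq_integral => r _.
  rewrite EFinM -lebesgue_sqr_lt.
  under eq_integral do rewrite EFinM.
  have my : measurable_fun setT (fun y : T => (x ^+ 2 + y ^+ 2 < r ^+ 2)%R).
    by apply: measurable_fun_ltr => //; apply: measurable_funD.
  rewrite ge0_integralZl//= ?lee_fin//; last first.
    by apply/measurable_EFinP; exact: measurableT_comp mbool my.
  congr (_ * _)%E; rewrite -[X in _ = _ X]setIT -integral_indic//.
    apply: eq_integral => y _; rewrite indicE; congr (EFin (GRing.natmul _ (nat_of_bool _))).
    by apply/idP/idP; rewrite inE/= ltrBrDl.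
  rewrite [X in measurable X](_ : _ =
      [set: T] `&` (fun y : T => x ^+ 2 + y ^+ 2 < r ^+ 2) @^-1` [set true]).
    exact: my.
  by rewrite setTI; apply/seteqP; split=> y /=; rewrite ltrBrDl.
pose S (z : T * T) : \bar R := (g z.2 * (2 * Num.sqrt (z.2 ^+ 2 - z.1 ^+ 2)))%:E.
have mS : measurable_fun setT S.
  apply/measurable_EFinP; apply: measurable_funM.
    exact: measurableT_comp mg _.
  apply: measurable_funM => //.
  apply: (measurableT_comp msqrt).
  by apply: measurable_funB; exact: msq.
have S0 z : (0 <= S z)%E by rewrite lee_fin; apply: mulr_ge0 => //; apply: mulr_ge0 => //; exact: sqrtr_ge0.
transitivity (\int[@lebesgue_measure R]_r \int[@lebesgue_measure R]_x S (x, r))%E.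
  exact: (@fubini_tonelli _ _ T T R lebesgue_measure lebesgue_measure S mS S0).
rewrite [RHS]integral_mkcond; apply: eq_integral => r _.
rewrite patchE /S /= /g indicE mem_setE in_itv/=.
case: (boolP (0 <= r <= 1)) => [/andP[r0 r1]|_]; last first.
  by rewrite integral0_eq// => x _; rewrite mulr0 mul0r.
under eq_integral do rewrite mulr1 EFinM.
rewrite ge0_integralZl//=; last 2 first.
- apply: (@continuous_emeasurable _ (fun x => 2 * Num.sqrt (r ^+ 2 - x ^+ 2))) => x.
  apply: cvgM; first exact: cvg_cst.
  apply: (@continuous_comp _ _ _ (fun x : R => r ^+ 2 - x ^+ 2) Num.sqrt).
    by apply: cvgB; [exact: cvg_cst|exact: exprn_continuous].
  exact: sqrt_continuous.
- by rewrite lee_fin oppr_ge0 dh0// in_itv/= r0 r1.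
rewrite EFinM; congr (_ * _)%E; have [->|rn0] := eqVneq r 0.
  rewrite expr0n mulr0 integral0_eq// => x _.
  by rewrite ler0_sqrtr ?mulr0// sub0r oppr_le0 sqr_ge0.
by apply: integral_chord; rewrite lt0r rn0.
Qed.

(** * Differentiation of the marginal *)

Lemma is_derive_slice1 (R : realType) (f : R * R -> R) (x y : R) :
  derivable f (x, y) (1, 0) ->
  is_derive x 1 (fun t => f (t, y)) ('D_(1, 0) f (x, y)).
Proof.
have E : (fun h : R => h^-1 *: (f (h *: (1, 0) + (x, y)) - f (x, y))) =
  (fun h : R => h^-1 *: (f (h *: 1 + x, y) - f (x, y))).
  apply/funext => h; congr (_ *: (f _ - _)).
  have -> : h *: (1, 0) + (x, y) = (h * 1 + x, h * 0 + y) :> R * R by [].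
  by rewrite mulr0 add0r.
move=> df; split; first by move: df; rewrite /derivable/= E.
by rewrite /derive /= E.
Qed.

Lemma is_derive_slice2 (R : realType) (f : R * R -> R) (x y : R) :
  derivable f (x, y) (0, 1) ->
  is_derive y 1 (fun t => f (x, t)) ('D_(0, 1) f (x, y)).
Proof.
have E : (fun h : R => h^-1 *: (f (h *: (0, 1) + (x, y)) - f (x, y))) =
  (fun h : R => h^-1 *: (f (x, h *: 1 + y) - f (x, y))).
  apply/funext => h; congr (_ *: (f _ - _)).
  have -> : h *: (0, 1) + (x, y) = (h * 0 + x, h * 1 + y) :> R * R by [].
  by rewrite mulr0 add0r.
move=> df; split; first by move: df; rewrite /derivable/= E.
by rewrite /derive /= E.
Qed.

Lemma continuous_slice1 (R : realType) (f : R * R -> R) (y : R) :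
  continuous f -> continuous (fun t => f (t, y)).
Proof.
move=> cf x; apply: (@continuous_comp _ _ _ (fun t : R => (t, y)) f); last exact: cf.
by apply: (@cvg_pair _ _ _ _ (nbhs (x : R)) (nbhs (y : R))); [exact: cvg_id|exact: cvg_cst].
Qed.

Lemma continuous_slice2 (R : realType) (f : R * R -> R) (x : R) :
  continuous f -> continuous (fun t => f (x, t)).
Proof.
move=> cf y; apply: (@continuous_comp _ _ _ (fun t : R => (x, t)) f); last exact: cf.
by apply: (@cvg_pair _ _ _ _ (nbhs (x : R)) (nbhs (y : R))); [exact: cvg_cst|exact: cvg_id].
Qed.

Lemma continuous_rect_bounded (R : realType) (f : R * R -> R) (a b c d : R) :
  continuous f -> exists2 M : R, 0 <= M &
    forall x y, x \in `[a, b] -> y \in `[c, d] -> `|f (x, y)| <= M.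
Proof.
move=> cf.
have : compact (f @` (`[a, b] `*` `[c, d])).
  apply: continuous_compact; first exact: continuous_subspaceT.
  by apply: compact_setX; exact: segment_compact.
move=> /compact_bounded[M [_ HM]]; exists (`|M| + 1) => // x y xab ycd.
have MM : M < `|M| + 1 by rewrite (le_lt_trans (ler_norm M))// ltrDl.
by apply: (HM _ MM (f (x, y))); exists (x, y).
Qed.

Lemma marginal_itv (R : realType) (f : R * R -> R) (x : R) :
  (forall z, 1 <= enorm z -> f z = 0) ->
  marginal f x = \int[@lebesgue_measure R]_(y in `[-1, 1]) f (x, y).
Proof.
move=> f1; rewrite /marginal [RHS]Rintegral_mkcond.
apply: eq_Rintegral => y _; rewrite patchE; case: ifPn => //.
rewrite notin_setE/= in_itv/= => /negP; rewrite -ler_norml -ltNge => y1.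
apply: f1; rewrite /enorm/= -[leLHS]sqrtr1 ler_wsqrtr//.
rewrite -[X in _ <= _ + X]real_normK ?num_real//.
by rewrite (le_trans (exprn_ege1 2 (ltW y1)))// lerDr sqr_ge0.
Qed.

Section marginal_derivative.
Variables (R : realType) (f : R * R -> R).
Hypotheses (cf : continuous f) (df : forall z, derivable f z (1, 0))
  (cdf : continuous ('D_(1, 0) f)) (f1 : forall z, 1 <= enorm z -> f z = 0).
Notation mu := (@lebesgue_measure R).

Let integrable_slice (g : R * R -> R) (x : R) : continuous g ->
  mu.-integrable `[-1, 1] (EFin \o (fun y => g (x, y))).
Proof.
move=> cg; apply: continuous_compact_integrable; first exact: segment_compact.
by apply: continuous_subspaceT; exact: continuous_slice2.
Qed.

Definition dmarginal (x : R) :=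
  \int[mu]_(y in `[-1, 1]) 'D_(1, 0) f (x, y).

(** Differentiation under the integral sign: near [x], the derivative of the
    integrand is dominated by its maximum over a compact rectangle. *)
Lemma is_derive_marginal (x : R) : is_derive x 1 (marginal f) (dmarginal x).
Proof.
have -> : marginal f = (fun x => \int[mu]_(y in `[-1, 1]) f (x, y)).
  by apply/funext => t; exact: marginal_itv.
have [M M0 fM] := continuous_rect_bounded (x - 1) (x + 1) (-1) 1 cdf.
have d1E (t y : R) : partial1of2 (fun t y => f (t, y)) t y = 'D_(1, 0) f (t, y).
  by rewrite partial1of2E; have [] := is_derive_slice1 (@df (t, y)).
have Ix : [set` `](x - 1), (x + 1)[] x by rewrite /= in_itv/=; lra.
have dff (t y : R) : [set` `](x - 1), (x + 1)[] t -> [set` `[-1, 1]] y ->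
    derivable (fun t => f (t, y)) t 1.
  by move=> _ _; have [] := is_derive_slice1 (@df (t, y)).
have iM : mu.-integrable `[-1, 1] (EFin \o cst M).
  apply: continuous_compact_integrable; first exact: segment_compact.
  by apply: continuous_subspaceT => ?; exact: cvg_cst.
have ub (t y : R) : [set` `](x - 1), (x + 1)[] t -> [set` `[-1, 1]] y ->
    `|partial1of2 (fun t y => f (t, y)) t y| <= cst M y.
  rewrite d1E/= => tx y1; apply: fM => //.
  by apply: subset_itv_oo_cc tx.
have intf (t : R) : [set` `](x - 1), (x + 1)[] t ->
   mu.-integrable `[-1, 1] (EFin \o (fun y => f (t, y))).
  by move=> _; exact: integrable_slice.
have mI : measurable (`[-1, 1] : set R) by exact: measurable_itv.
have cM0 (y : R) : 0 <= cst M y by [].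
pose F (t : R) (y : measurableTypeR R) := f (t, y).
have := derivable_under_integral (f := F) mI Ix intf dff cM0 iM ub.
have := differentiation_under_integral (f := F) mI Ix intf dff cM0 iM ub.
move=> dE dd; split; first exact: dd.
rewrite -derive1E dE.
by apply: eq_Rintegral => y _; exact: d1E.
Qed.

Lemma continuous_dmarginal : continuous dmarginal.
Proof.
move=> x.
have [M M0 fM] := continuous_rect_bounded (x - 1) (x + 1) (-1) 1 cdf.
have iM : mu.-integrable `[-1, 1] (EFin \o cst M).
  apply: continuous_compact_integrable; first exact: segment_compact.
  by apply: continuous_subspaceT => ?; exact: cvg_cst.
apply: (@continuity_under_integral _ _ _ mu (fun (t : R) (y : measurableTypeR R) => 'D_(1, 0) f (t, y)) `[-1, 1] _
  (x - 1) (x + 1) _ _ (cst M) iM).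
- exact: measurable_itv.
- by move=> t _; exact: (@integrable_slice ('D_(1, 0) f) t cdf).
- by apply: aeW => y _ t _; exact: (@continuous_slice1 _ ('D_(1, 0) f) y cdf t).
- move=> t tx; apply: aeW => y y1; apply: fM => //.
  exact: subset_itv_oo_cc tx.
- by rewrite inE/= in_itv/=; lra.
Qed.

End marginal_derivative.

(** * Radial structure of a mollifier *)

Lemma is_derive_le0 (R : realType) (f : R -> R) (a d : R) :
  is_derive a 1 f d -> (forall t, a < t -> f t <= f a) -> d <= 0.
Proof.
move=> [df dE] fa; rewrite -dE leNgt; apply/negP => d0.
have /(cvgr_gt (f := fun h => h^-1 *: ((f \o shift a) (h *: 1) - f a))) := df.
move=> /(_ 0 d0)[e /= e0 He].
have he0 : 0 < e / 2 by rewrite divr_gt0.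
(* A positive derivative would make the difference quotient positive at [e / 2]. *)
have := He (e / 2); rewrite /= sub0r normrN gtr0_norm// ltr_pdivrMr// ltr_pMr// ltr1n.
move=> /(_ isT) /(_ (lt0r_neq0 he0)).
rewrite /GRing.scale/= pmulr_rgt0 ?invr_gt0// mulr1 subr_gt0.
by rewrite ltNge fa// ltrDr.
Qed.

Section profile.
Variables (R : realType) (phi : R * R -> R) (mphi : mollifier R phi).

Lemma mollifier_continuous : continuous phi.
Proof. by have [[/(_ 0%N)[]]] := mphi. Qed.

Lemma mollifier_derivable1 z : derivable phi z (1, 0).
Proof. by have [[/(_ 1%N)[_ []]]] := mphi. Qed.

Lemma mollifier_derivable2 z : derivable phi z (0, 1).
Proof. by have [[/(_ 1%N)[_ []]]] := mphi. Qed.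

Lemma is_derive_mollifier1 (x y : R) :
  is_derive x 1 (fun t => phi (t, y)) ('D_(1, 0) phi (x, y)).
Proof. exact/is_derive_slice1/mollifier_derivable1. Qed.

Lemma is_derive_mollifier2 (x y : R) :
  is_derive y 1 (fun t => phi (x, t)) ('D_(0, 1) phi (x, y)).
Proof. exact/is_derive_slice2/mollifier_derivable2. Qed.

Lemma mollifier_continuous1 : continuous ('D_(1, 0) phi).
Proof. by have [[/(_ 1%N)[_ [_ _ []]]]] := mphi. Qed.

Lemma mollifier_continuous2 : continuous ('D_(0, 1) phi).
Proof. by have [[/(_ 1%N)[_ [_ _ _ []]]]] := mphi. Qed.

Lemma mollifier_radial z w : enorm z = enorm w -> phi z = phi w.
Proof. by have [[_ r _] _] := mphi; exact: r. Qed.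

Lemma mollifier_ge0 z : 0 <= phi z.
Proof. by have [[]] := mphi. Qed.

Lemma mollifier_nincr z w : enorm z <= enorm w -> phi w <= phi z.
Proof. by have [_ [_ _ r]] := mphi; exact: r. Qed.

Lemma enorm_axis (r : R) : 0 <= r -> enorm (r, 0) = r.
Proof. by move=> r0; rewrite /enorm/= expr0n addr0 sqrtr_sqr ger0_norm. Qed.

Lemma enorm_ge0 (z : R * R) : 0 <= enorm z.
Proof. exact: sqrtr_ge0. Qed.

Lemma mollifier_profile z : phi (enorm z, 0) = phi z.
Proof. by apply: mollifier_radial; rewrite enorm_axis// enorm_ge0. Qed.

(** The condition on the support controls the open exterior of the unit disk; the
    value on the unit circle follows by continuity. *)
Lemma mollifier_eq0 z : 1 <= enorm z -> phi z = 0.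
Proof.
have far w : 1 < enorm w -> phi w = 0.
  move=> w1; apply/eqP/negPn/negP => w0.
  have [_ [sub _ _]] := mphi.
  have /sub/= : closure [set z | phi z != 0] w by exact: subset_closure.
  by rewrite leNgt w1.
rewrite le_eqVlt => /predU1P[z1|]; last exact: far.
rewrite -mollifier_profile -z1.
have c : (fun t => phi (t, 0)) @ (1 : R)^'+ --> phi (1, 0).
  apply: cvg_at_right_filter.
  exact: (@continuous_slice1 _ phi 0 mollifier_continuous).
have c0 : (fun t => phi (t, 0)) @ (1 : R)^'+ --> (0 : R).
  apply: cvg_near_cst; near=> t; apply: far; rewrite enorm_axis//.
  by apply: (@le_trans _ _ 1).
exact: cvg_unique c c0.
Unshelve. all: by end_near. Qed.

Lemma mollifier_D1_le0 x y : 0 <= x -> 'D_(1, 0) phi (x, y) <= 0.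
Proof.
move=> x0.
apply: (is_derive_le0 (is_derive_mollifier1 x y)).
move=> t xt; apply: mollifier_nincr; rewrite /enorm/= ler_wsqrtr// lerD2r.
by rewrite ler_pXn2r ?nnegrE// ?ltW// (le_lt_trans x0 xt).
Qed.

(** The gradient of a radial function is proportional to the position vector. *)
Lemma mollifier_D1D2 x y : 0 < x ->
  y * 'D_(1, 0) phi (x, y) = x * 'D_(0, 1) phi (x, y).
Proof.
move=> x0; pose rho := Num.sqrt (x ^+ 2 + y ^+ 2).
have q0 : 0 < x ^+ 2 + y ^+ 2 by rewrite ltr_pwDl ?sqr_ge0// exprn_gt0.
have rho0 : 0 < rho by rewrite sqrtr_gt0.
have dh : is_derive rho 1 (fun t => phi (t, 0)) ('D_(1, 0) phi (rho, 0)).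
  exact: (is_derive_mollifier1 rho 0).
have -> : 'D_(1, 0) phi (x, y) = 'D_(1, 0) phi (rho, 0) * ((2 * rho)^-1 * (2 * x)).
  have [_ <-] := is_derive_mollifier1 x y.
  have -> : (fun t => phi (t, y)) = (fun t => phi (t, 0)) \o
      (Num.sqrt \o (fun t => t ^+ 2 + y ^+ 2)).
    by apply/funext => t /=; rewrite -mollifier_profile.
  apply: derive_val.
  apply: is_derive1_comp => //; apply: is_derive1_comp; first exact: is_derive1_sqrt.
  by apply: is_derive_eq; rewrite /GRing.scale/=; ring.
have -> : 'D_(0, 1) phi (x, y) = 'D_(1, 0) phi (rho, 0) * ((2 * rho)^-1 * (2 * y)).
  have [_ <-] := is_derive_mollifier2 x y.
  have -> : (fun t => phi (x, t)) = (fun t => phi (t, 0)) \o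
      (Num.sqrt \o (fun t => x ^+ 2 + t ^+ 2)).
    by apply/funext => t /=; rewrite -mollifier_profile.
  apply: derive_val.
  apply: is_derive1_comp => //; apply: is_derive1_comp; first exact: is_derive1_sqrt.
  by apply: is_derive_eq; rewrite /GRing.scale/=; ring.
by ring.
Qed.

End profile.

(** * The pointwise inequality for the marginal *)

Section marginal_of_mollifier.
Variables (R : realType) (phi : R * R -> R) (mphi : mollifier R phi).
Notation mu := (@lebesgue_measure R).
Notation D1 := ('D_(1, 0) phi).
Notation D2 := ('D_(0, 1) phi).

Lemma is_derive_mollifier_marginal (x : R) :
  is_derive x 1 (marginal phi) (dmarginal phi x).
Proof.
apply: is_derive_marginal.
- exact: mollifier_continuous mphi.
- exact: mollifier_derivable1 mphi.
- exact: mollifier_continuous1 mphi.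
- exact: mollifier_eq0 mphi.
Qed.

Lemma derive1_mollifier_marginal (x : R) :
  derive1 (marginal phi) x = dmarginal phi x.
Proof. by rewrite derive1E; have [] := is_derive_mollifier_marginal x. Qed.

Lemma continuous_mollifier_marginal : continuous (marginal phi).
Proof.
by move=> x; exact: is_derive1_continuous (is_derive_mollifier_marginal x).
Qed.

Lemma continuous_mollifier_dmarginal : continuous (dmarginal phi).
Proof. exact: continuous_dmarginal (mollifier_continuous1 mphi). Qed.

Lemma marginal_half (x : R) :
  marginal phi x = 2 * \int[mu]_(y in `[0, 1]) phi (x, y).
Proof.
rewrite marginal_itv; last exact: mollifier_eq0 mphi.
apply: Rintegral_even => //.
  exact: (@continuous_slice2 _ phi x (mollifier_continuous mphi)).
by move=> y; apply: (mollifier_radial mphi); rewrite /enorm/= sqrrN.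
Qed.

Lemma mollifier_D1_even (x y : R) : D1 (x, - y) = D1 (x, y).
Proof.
have [_ <-] := is_derive_mollifier1 mphi x y.
have [_ <-] := is_derive_mollifier1 mphi x (- y).
have -> // : (fun t => phi (t, - y)) = (fun t => phi (t, y)).
  by apply/funext => t; apply: (mollifier_radial mphi); rewrite /enorm/= sqrrN.
Qed.

Lemma dmarginal_half (x : R) :
  dmarginal phi x = 2 * \int[mu]_(y in `[0, 1]) D1 (x, y).
Proof.
apply: Rintegral_even => //.
  exact: (@continuous_slice2 _ D1 x (mollifier_continuous1 mphi)).
by move=> y; exact: mollifier_D1_even.
Qed.

Lemma marginal_even (x : R) : marginal phi (- x) = marginal phi x.
Proof.
rewrite !marginal_half; congr (2 * _); apply: eq_Rintegral => y _.
by apply: (mollifier_radial mphi); rewrite /enorm/= sqrrN.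
Qed.

Lemma dmarginal_odd (x : R) : dmarginal phi (- x) = - dmarginal phi x.
Proof.
have [_ <-] := is_derive_mollifier_marginal (- x).
have d : is_derive x 1 (marginal phi \o -%R) ('D_1 (marginal phi) (- x) * (- 1)).
  apply: is_derive1_comp.
  by have [d1 _] := is_derive_mollifier_marginal (- x); exact: derivableP.
have e : marginal phi \o -%R = marginal phi.
  by apply/funext => t /=; exact: marginal_even.
rewrite e in d; have [_ <-] := is_derive_mollifier_marginal x.
by have [_ ->] := d; rewrite mulrN1 opprK.
Qed.

Lemma marginal_ge0 (x : R) : 0 <= marginal phi x.
Proof. by apply: Rintegral_ge0 => y _; exact: mollifier_ge0. Qed.

Lemma dmarginal_le0 (x : R) : 0 <= x -> dmarginal phi x <= 0.
Proof.
move=> x0; apply: (is_derive_le0 (is_derive_mollifier_marginal x)) => t xt.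
rewrite !marginal_half ler_pM2l//; apply: le_Rintegral => //.
- apply: continuous_itv_integrable.
  exact: (@continuous_slice2 _ phi t (mollifier_continuous mphi)).
- apply: continuous_itv_integrable.
  exact: (@continuous_slice2 _ phi x (mollifier_continuous mphi)).
- move=> y _; apply: (mollifier_nincr mphi); rewrite /enorm/= ler_wsqrtr//.
  rewrite lerD2r ler_pXn2r ?nnegrE ?(ltW xt)//.
  exact: le_trans x0 (ltW xt).
Qed.

(** Expansion of [0 <= \int q y * (1 - l * |y|) ^+ 2] for the weight
    [q y = - 'D_(1, 0) phi (x, y)], which is nonnegative since [phi] decreases.
    By [mollifier_D1D2], [y * q y = - x * 'D_(0, 1) phi (x, y)], so that the terms
    in [l] and [l ^+ 2] are integrated by parts. *)
Lemma marginal_quadratic_ge0 (x l : R) : 0 < x ->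
  0 <= - dmarginal phi x + l ^+ 2 * (x * marginal phi x)
       - 4 * l * (x * phi (x, 0)).
Proof.
move=> x0.
have cp := @continuous_slice2 _ phi x (mollifier_continuous mphi).
have cD1 := @continuous_slice2 _ D1 x (mollifier_continuous1 mphi).
have cD2 := @continuous_slice2 _ D2 x (mollifier_continuous2 mphi).
have cpoly : continuous (fun y : R => (1 - l * y) ^+ 2).
  move=> y; apply: (@is_derive1_continuous _ _ _ (2 * (1 - l * y) * (- l))).
  by apply: is_derive_eq; rewrite /GRing.scale/=; ring.
have cw : continuous (fun y => D1 (x, y) * (1 - l * y) ^+ 2).
  by move=> y; apply: cvgM; [exact: cD1|exact: cpoly].
(* [F] is a primitive of [q y * (1 - l * y) ^+ 2 - q y - l ^+ 2 * x * phi (x, y)], and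
   it vanishes at 1. *)
pose F (y : R) := x * phi (x, y) * (2 * l - l ^+ 2 * y).
have : \int[mu]_(y in `[0, 1])
    (D1 (x, y) - D1 (x, y) * (1 - l * y) ^+ 2 - l ^+ 2 * x * phi (x, y)) = F 1 - F 0.
  rewrite /Rintegral (integral_is_derive (F := F))//.
  - move=> y _; have dy := is_derive_mollifier2 mphi x y.
    rewrite /F; apply: is_derive_eq; rewrite /GRing.scale/=.
    transitivity (y * D1 (x, y) * (2 * l - l ^+ 2 * y) - l ^+ 2 * x * phi (x, y)).
      by rewrite (mollifier_D1D2 mphi)//; ring.
    by ring.
  - apply: continuous_subspaceT => y; apply: cvgB; first apply: cvgB.
    + exact: cD1.
    + exact: cw.
    + by apply: cvgM; [exact: cvg_cst|exact: cp].
rewrite /F (mollifier_eq0 mphi (z := (x, 1))); last first.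
  by rewrite /enorm/= expr1n -[leLHS]sqrtr1 ler_wsqrtr// lerDr sqr_ge0.
rewrite (@RintegralB_continuous _ (fun y => D1 (x, y) - D1 (x, y) * (1 - l * y) ^+ 2)
  (fun y => l ^+ 2 * x * phi (x, y))); last 2 first.
- by move=> y; apply: cvgB; [exact: cD1|exact: cw].
- by move=> y; apply: cvgM; [exact: cvg_cst|exact: cp].
rewrite (RintegralB_continuous _ _ cD1 cw) (RintegralZl_continuous _ _ _ cp).
have : \int[mu]_(y in `[0, 1]) (D1 (x, y) * (1 - l * y) ^+ 2) <= 0.
  rewrite -oppr_ge0 -mulN1r -(RintegralZl_continuous _ _ _ cw).
  apply: Rintegral_ge0 => y _; rewrite mulN1r oppr_ge0 mulr_le0_ge0 ?sqr_ge0//.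
  by apply: (mollifier_D1_le0 mphi); exact: ltW.
by rewrite dmarginal_half marginal_half; lra.
Qed.

(** Cauchy-Schwarz, as the discriminant of the quadratic inequality above. *)
Lemma marginal_dmarginal_ge (x : R) : 0 < x ->
  4 * x * phi (x, 0) ^+ 2 <= - (marginal phi x * dmarginal phi x).
Proof.
move=> x0; have P0 := marginal_ge0 x; have p0 := mollifier_ge0 mphi (x, 0).
have Q l := marginal_quadratic_ge0 l x0.
set P := marginal phi x in P0 Q *; set p := phi (x, 0) in p0 Q *.
set d := dmarginal phi x in Q *.
have [P1|] := ltP 0 P.
  (* The minimum of the quadratic polynomial is at [2 * p / P]. *)
  have := Q (2 * p / P).
  have -> : - d + (2 * p / P) ^+ 2 * (x * P) - 4 * (2 * p / P) * (x * p) =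
     (- (P * d) - 4 * x * p ^+ 2) / P by field; lra.
  by rewrite pmulr_lge0 ?invr_gt0// subr_ge0.
rewrite le_eqVlt ltNge P0 orbF => /eqP P1; rewrite P1 in Q *.
(* When [Phi x = 0] the inequality is affine in [l], hence has no slope. *)
rewrite mul0r oppr0; have [->|pn0] := eqVneq p 0; first by rewrite expr0n mulr0.
have xp : 0 < x * p by rewrite mulr_gt0// lt0r pn0.
have := Q ((- d + 1) / (4 * (x * p))).
have -> : - d + ((- d + 1) / (4 * (x * p))) ^+ 2 * (x * 0) -
  4 * ((- d + 1) / (4 * (x * p))) * (x * p) = - 1 by field; lra.
by rewrite oppr_ge0 ler10.
Qed.

End marginal_of_mollifier.

(** * The extremal problem for radial profiles *)

(** Let [F x = \int_0^x 2 u f u]. Monotonicity of [f] makes [F] a concave function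
    of [x ^+ 2], hence [x ^+ 2 * f x <= F x] and [x ^+ 2 <= F x]; both are
    equalities when [f] is the constant 1, which is the minimizer. The function [P]
    below is such that [P'] is at most the integrand, with equality for that
    minimizer. It is found by bounding [f `^ t] from below by
    [f * (F / x ^+ 2) `^ (t - 1)], integrating by parts, and replacing [F] by
    [x ^+ 2] in the remaining integral, which is allowed since
    [x `^ (1 - 3 * t / 2)] is nonincreasing for [2 / 3 <= t]. *)
Lemma integral_powR_profile (R : realType) (f : R -> R) (t : R) :
  2 / 3 <= t <= 1 -> continuous f -> (forall x, 0 <= f x) ->
  (forall x y, 0 <= x -> x <= y -> f y <= f x) ->
  (\int[@lebesgue_measure R]_(x in `[0%R, 1%R]) (2 * x * f x)%:E = 1)%E ->
  ((2 / (t + 2))%:E <=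
    \int[@lebesgue_measure R]_(x in `[0%R, 1%R]) (x `^ (t / 2) * f x `^ t)%:E)%E.
Proof.
move=> /andP[t23 t1] cf f0 fD f1.
have c2 : continuous (fun x : R => 2 * x * f x).
  by move=> x; apply: cvgM; [apply: cvgM; [exact: cvg_cst|exact: cvg_id]|exact: cf].
have [F [F0 dF]] := antiderivative c2.
have F1 : F 1 = 1.
  move: f1; rewrite (integral_is_derive (F := F))//; last exact: continuous_subspaceT.
  by rewrite F0 subr0 => -[].
have Fl x : 0 <= x -> x <= 1 -> x ^+ 2 * f x <= F x.
  move=> x0 x1; rewrite -subr_ge0.
  pose D y := F y - y ^+ 2 * f x.
  have : D 0 <= D x.
    apply: (is_derive_ge0_le (f := fun y => 2 * y * f y - 2 * y * f x)) => //.
      move=> y; rewrite in_itv/= => /andP[y0 yx].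
      have dFy : is_derive y 1 F (2 * y * f y) by apply: dF; rewrite in_itv/= y0 (le_trans yx).
      by apply: is_derive_eq; rewrite /GRing.scale/=; ring.
    move=> y /andP[y0 yx]; rewrite -mulrBr mulr_ge0 ?subr_ge0 ?fD ?ltW//.
    by rewrite mulr_gt0.
  by rewrite /D F0; lra.
have Fu x : 0 <= x -> x <= 1 -> 1 - (1 - x ^+ 2) * f x <= F x.
  move=> x0 x1; pose D y := y ^+ 2 * f x - F y.
  have : D x <= D 1.
    apply: (is_derive_ge0_le (f := fun y => 2 * y * f x - 2 * y * f y)) => //.
      move=> y; rewrite in_itv/= => /andP[xy y1].
      have dFy : is_derive y 1 F (2 * y * f y) by apply: dF; rewrite in_itv/= y1 (le_trans x0).
      by apply: is_derive_eq; rewrite /GRing.scale/=; ring.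
    move=> y /andP[xy y1]; rewrite -mulrBr mulr_ge0 ?subr_ge0 ?fD ?(ltW xy)//.
    by rewrite mulr_ge0// (le_trans x0 (ltW xy)).
  by rewrite /D F1; lra.
have Fx x : 0 <= x -> x <= 1 -> x ^+ 2 <= F x.
  move=> x0 x1; have := Fl x x0 x1; have := Fu x x0 x1.
  have : 0 <= x ^+ 2 by rewrite sqr_ge0.
  have : x ^+ 2 <= 1 by rewrite expr_le1.
  by nra.
have F00 x : 0 <= x -> x <= 1 -> F x <= x ^+ 2 * f 0.
  move=> x0 x1; pose D y := y ^+ 2 * f 0 - F y.
  have : D 0 <= D x.
    apply: (is_derive_ge0_le (f := fun y => 2 * y * f 0 - 2 * y * f y)) => //.
      move=> y; rewrite in_itv/= => /andP[y0 yx].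
      have dFy : is_derive y 1 F (2 * y * f y) by apply: dF; rewrite in_itv/= y0 (le_trans yx).
      by apply: is_derive_eq; rewrite /GRing.scale/=; ring.
    move=> y /andP[y0 yx]; rewrite -mulrBr mulr_ge0 ?subr_ge0 ?fD ?(ltW y0)//.
    by rewrite mulr_ge0 ?(ltW y0).
  by rewrite /D F0; lra.
have t0 : 0 <= t by lra.
have powR_le (r u v : R) : 0 <= r -> 0 <= u -> u <= v -> u `^ r <= v `^ r.
  by move=> r0 u0 uv; apply: ge0_ler_powR => //; rewrite nnegrE ?(le_trans u0).
pose a := 1 - 3 * t / 2.
pose c := (3 * t - 2) / (t + 2).
have a0 : a <= 0 by rewrite /a; lra.
have c0 : 0 <= c by rewrite /c divr_ge0//; lra.
pose P x := (x `^ a * F x `^ t + c * x `^ (1 + t / 2)) / (2 * t).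
pose dP x := (- a / (2 * t)) * (x `^ (t / 2) - x `^ (a - 1) * F x `^ t)
   + x `^ (a + 1) * F x `^ (t - 1) * f x.
have P1 : P 1 = 2 / (t + 2).
  by rewrite /P F1 !powR1 /c; field; lra.
have dPE e : 0 < e -> {in `[e, 1], forall x : R, is_derive x 1 P (dP x)}.
  move=> e0 x; rewrite in_itv/= => /andP[ex x1]; have x0 : 0 < x by exact: lt_le_trans ex.
  have Fx0 : 0 < F x by rewrite (lt_le_trans _ (Fx _ (ltW x0) x1))// exprn_gt0.
  have dFx : is_derive x 1 F (2 * x * f x) by apply: dF; rewrite in_itv/= x1 ltW.
  have dFt : is_derive x 1 (fun x => F x `^ t) (t * F x `^ (t - 1) * (2 * x * f x)).
    exact: (@is_derive1_comp _ (fun y : R => y `^ t) F x _ _ (is_derive1_powR t Fx0) dFx).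
  have da := is_derive1_powR a x0.
  have dt := is_derive1_powR (1 + t / 2) x0.
  rewrite /P; apply: is_derive_eq; rewrite /GRing.scale/= /dP.
  rewrite (_ : 1 + t / 2 - 1 = t / 2); last by ring.
  rewrite (powRD (r := a) (s := 1)); last by rewrite (gt_eqF x0) implybT.
  rewrite (powRr1 (ltW x0)) /c /a.
  by field; lra.
have cdP e : 0 < e -> {within `[e, 1], continuous dP}.
  move=> e0; apply: continuous_in_subspaceT => x.
  rewrite inE/= in_itv/= => /andP[ex x1]; have x0 : 0 < x by exact: lt_le_trans ex.
  have Fx0 : 0 < F x by rewrite (lt_le_trans _ (Fx _ (ltW x0) x1))// exprn_gt0.
  have dFx : is_derive x 1 F (2 * x * f x) by apply: dF; rewrite in_itv/= x1 ltW.
  have cF r : {for x, continuous (fun x => F x `^ r)}.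
    apply: is_derive1_continuous.
    exact: (@is_derive1_comp _ (fun y : R => y `^ r) F x _ _ (is_derive1_powR r Fx0) dFx).
  have cx r : {for x, continuous (fun x => x `^ r)}.
    exact: is_derive1_continuous (is_derive1_powR r x0).
  apply: cvgD.
    by apply: cvgM; [exact: cvg_cst|apply: cvgB; [exact: cx|apply: cvgM; [exact: cx|exact: cF]]].
  by apply: cvgM; [apply: cvgM; [exact: cx|exact: cF]|exact: cf].
have le_dP e : 0 < e -> {in `[e, 1], forall x, dP x <= x `^ (t / 2) * f x `^ t}.
  move=> e0 x; rewrite in_itv/= => /andP[ex x1]; have x0 : 0 < x by exact: lt_le_trans ex.
  have x2 (r : R) : (x ^+ 2) `^ r = x `^ (2 * r) by rewrite -powR_mulrn ?ltW// -powRrM.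
  have x20 : 0 < x ^+ 2 by rewrite exprn_gt0.
  have xn0 (r s : R) : (r + s == 0) ==> (x != 0) by rewrite (gt_eqF x0) implybT.
  have i1 : x `^ (t / 2) <= x `^ (a - 1) * F x `^ t.
    rewrite (_ : t / 2 = a - 1 + 2 * t); last by rewrite /a; field.
    rewrite (powRD (xn0 (a - 1) (2 * t))) ler_wpM2l ?powR_ge0// -x2.
    by apply: powR_le => //; [exact: ltW|exact: Fx (ltW x0) x1].
  have i2 : x `^ (a + 1) * F x `^ (t - 1) * f x <= x `^ (t / 2) * f x `^ t.
    have [->|fn0] := eqVneq (f x) 0; first by rewrite mulr0 mulr_ge0// powR_ge0.
    have fx0 : 0 < f x by rewrite lt0r fn0 f0.
    rewrite (_ : t / 2 = (a + 1) + 2 * (t - 1)); last by rewrite /a; field.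
    rewrite (powRD (xn0 (a + 1) (2 * (t - 1)))) -x2 -!mulrA ler_wpM2l ?powR_ge0//.
    rewrite -(mulr_powRB1 (ltW fx0)); last lra.
    rewrite [leRHS]mulrCA [leLHS]mulrC ler_wpM2l ?f0// -powRM ?(ltW x20)//.
    have Fx0 : 0 < F x by exact: lt_le_trans x20 (Fx x (ltW x0) x1).
    rewrite -[t - 1]opprB !powRN lef_pV2 ?posrE ?powR_gt0 ?mulr_gt0//.
    apply: powR_le; first lra.
      by rewrite mulr_ge0// ltW.
    exact: Fl (ltW x0) x1.
  have : 0 <= (- a / (2 * t)) by rewrite divr_ge0//; lra.
  move=> k0; rewrite /dP -[leRHS]add0r lerD// mulr_ge0_le0// subr_le0//.
pose C := (f 0 `^ t + c) / (2 * t).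
have C0 : 0 <= C by rewrite divr_ge0// ?addr_ge0 ?powR_ge0//; lra.
(* [P] tends to 0 at 0, since [F x <= x ^+ 2 * f 0]. *)
have Pe e : 0 < e -> e <= 1 -> P e <= C * e.
  move=> e0 e1.
  have h1 : e `^ (1 + t / 2) <= e.
    by rewrite -[leRHS](powRr1 (ltW e0)) ger_powR ?e0//; lra.
  have h2 : e `^ a * F e `^ t <= e `^ (1 + t / 2) * f 0 `^ t.
    rewrite (_ : 1 + t / 2 = a + 2 * t); last by rewrite /a; field.
    rewrite (powRD (r := a) (s := 2 * t)); last by rewrite (gt_eqF e0) implybT.
    rewrite -mulrA ler_wpM2l ?powR_ge0//.
    have -> : e `^ (2 * t) = (e ^+ 2) `^ t by rewrite -powR_mulrn ?ltW// -powRrM.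
    rewrite -powRM ?sqr_ge0//; apply: powR_le => //; last exact: F00 (ltW e0) e1.
    by rewrite (le_trans (sqr_ge0 e))// Fx// ltW.
  rewrite /P /C [leRHS]mulrAC ler_wpM2r ?invr_ge0 ?mulr_ge0//.
  rewrite mulrDl lerD//.
    by rewrite (le_trans h2)// mulrC ler_wpM2l ?powR_ge0.
  by rewrite ler_wpM2l.
set I := (X in (_ <= X)%E).
have main e : 0 < e -> e < 1 -> ((2 / (t + 2) - C * e)%:E <= I)%E.
  move=> e0 e1.
  have mw : measurable_fun setT (fun x => x `^ (t / 2) * f x `^ t).
    apply: measurable_funM; first exact: measurable_powR.
    apply: (measurableT_comp (measurable_powR t)).
    exact: continuous_measurable_fun.
  have w0 x : 0 <= x `^ (t / 2) * f x `^ t by rewrite mulr_ge0// powR_ge0.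
  have := le_integral_continuous (cdP e e0) mw w0 (le_dP e e0).
  rewrite (integral_is_derive (F := P) (ltW e1) (dPE _ e0) (cdP e e0)) P1.
  move=> h; apply: (@le_trans _ _ (2 / (t + 2) - P e)%:E).
    by rewrite lee_fin lerD2l lerN2 Pe// ltW.
  apply: (le_trans h); apply: ge0_subset_integral => //.
  - by apply/measurable_EFinP; exact: measurable_funTS.
  - by move=> x _; rewrite lee_fin.
  - by apply: subset_itvr; rewrite bnd_simp ltW.
apply/lee_addgt0Pr => e e0.
pose e' := Num.min (1 / 2) (e / (C + 1)).
have e'0 : 0 < e' by rewrite lt_min divr_gt0//= divr_gt0// ltr_wpDl.
have e'1 : e' < 1 by rewrite gt_min (_ : 1 / 2 < 1)//; lra.
have e'e : C * e' <= e.
  have : e' <= e / (C + 1) by rewrite ge_min lexx orbT.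
  rewrite ler_pdivlMr; last by rewrite ltr_wpDl.
  by nra.
have := main _ e'0 e'1; rewrite EFinB leeBlDr//.
by move=> /le_trans; apply; rewrite leeD2l// lee_fin.
Qed.

(** * The lower bound *)

(** The absolute value is there because [powR] is not continuous at 0 from the left. *)
Lemma continuous_norm_powR (R : realType) (r : R) : 0 < r ->
  continuous (fun y : R => `|y| `^ r).
Proof.
move=> r0 y; have [->|yn0] := eqVneq y 0.
  apply/cvgrPdist_lt => e e0; near=> z.
  rewrite normr0 powR0 ?gt_eqF// sub0r normrN ger0_norm ?powR_ge0//.
  rewrite -[ltRHS](powRr1 (ltW e0)) -(mulVf (lt0r_neq0 r0)) powRrM.
  rewrite gt0_ltr_powR ?nnegrE ?powR_ge0// -[z]subr0 distrC.
  near: z; apply: cvgr_dist_lt; last exact: powR_gt0.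
  exact: cvg_id.
apply: (@continuous_comp _ _ _ (fun y : R => `|y|) (fun u => u `^ r)).
  exact: norm_continuous.
by apply: is_derive1_continuous (is_derive1_powR r _); rewrite normr_gt0.
Unshelve. all: by end_near. Qed.

Section Cconst_of_mollifier.
Variables (R : realType) (phi : R * R -> R) (mphi : mollifier R phi).
Notation mu := (@lebesgue_measure R).

Lemma marginal_eq0 (b x : R) : (forall z, b <= enorm z -> phi z = 0) ->
  b <= x -> marginal phi x = 0.
Proof.
move=> phib bx; rewrite /marginal (@eq_Rintegral _ _ _ _ _ (fun=> 0)).
  by rewrite Rintegral_cst//= mul0r.
move=> y _; apply: phib; rewrite (le_trans bx)// (le_trans (ler_norm x))//.
by rewrite -sqrtr_sqr ler_wsqrtr//= lerDl sqr_ge0.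
Qed.

(** The integrand of the norm is even and vanishes beyond the radius of the support,
    and [Phi Phi' <= 0] on the positive side. *)
Lemma CconstE (p : \bar R) (b : R) : (1 <= p)%E -> 0 < tau p -> 0 < b ->
  (forall z, b <= enorm z -> phi z = 0) ->
  Cconst p phi = ((2%:E * \int[mu]_(x in `[0%R, b])
    ((- (marginal phi x * dmarginal phi x)) `^ (tau p / 2))%:E) `^ (tau p)^-1)%E.
Proof.
move=> p1 t0 b0 phib; rewrite /Cconst unlock; congr (_ `^ _)%E.
have cf : continuous (fun x => `|marginal phi x * dmarginal phi x| `^ (tau p / 2)).
  move=> x; apply: (@continuous_comp _ _ _ (fun x => marginal phi x * dmarginal phi x)
      (fun u => `|u| `^ (tau p / 2))).
    apply: cvgM; first exact: continuous_mollifier_marginal.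
    exact: continuous_mollifier_dmarginal.
  by apply: continuous_norm_powR; rewrite divr_gt0.
transitivity (\int[mu]_x (`|marginal phi x * dmarginal phi x| `^ (tau p / 2))%:E)%E.
  apply: eq_integral => x _ /=; rewrite ger0_norm ?sqrtr_ge0//.
  rewrite derive1_mollifier_marginal// -powR12_sqrt ?normr_ge0//.
  by rewrite -powRrM (mulrC 2^-1).
transitivity (2%:E * \int[mu]_(x in [set x : R | (0 <= x)%R])
    (`|marginal phi x * dmarginal phi x| `^ (tau p / 2))%:E)%E.
  apply: (@ge0_symfun_integralT R
    (fun x => `|marginal phi x * dmarginal phi x| `^ (tau p / 2))).
  - by move=> x; rewrite powR_ge0.
  - exact: cf.
  - move=> x /=; rewrite (marginal_even mphi) (dmarginal_odd mphi) mulrN normrN.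
    by [].
congr (_ * _)%E; rewrite integral_mkcond [RHS]integral_mkcond.
apply: eq_integral => x _; rewrite !patchE.
have -> : (x \in [set x : R | 0 <= x]) = (0 <= x) by apply/idP/idP; rewrite inE.
have -> : (x \in `[0, b]%classic) = (0 <= x <= b) by rewrite mem_setE in_itv.
case: (leP 0 x) => x0 //=; case: (leP x b) => xb.
  have x1 : marginal phi x * dmarginal phi x <= 0.
    by apply: mulr_ge0_le0; [exact: marginal_ge0|exact: dmarginal_le0].
  by rewrite (ler0_norm x1).
by rewrite (marginal_eq0 phib (ltW xb)) mul0r normr0 powR0// gt_eqF// divr_gt0.
Qed.

(** The condition [\int phi = 1] in polar coordinates: [integral_radial] integrated
    by parts. *)
Lemma integral_profile :
  (\int[mu]_(x in `[0%R, 1%R]) (2 * x * (pi * phi (x, 0)))%:E = 1)%E.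
Proof.
have ch := @continuous_slice1 _ phi 0 (mollifier_continuous mphi).
have cdh := @continuous_slice1 _ ('D_(1, 0) phi) 0 (mollifier_continuous1 mphi).
have dh (x : R) := is_derive_mollifier1 mphi x 0.
have m1 : (\int[mu \x mu]_z (phi z)%:E = 1)%E by have [_ []] := mphi.
have : (\int[mu \x mu]_z (phi (enorm z, 0%R))%:E = 1)%E.
  by rewrite -[RHS]m1; apply: eq_integral => z _; rewrite mollifier_profile.
have ax (r : R) : 1 <= r -> phi (r, 0) = 0.
  move=> r1; apply: (mollifier_eq0 mphi); rewrite enorm_axis//.
  exact: le_trans r1.
rewrite (@integral_radial _ (fun r => phi (r, 0)) (fun r => 'D_(1, 0) phi (r, 0)))//; last 2 first.
- by move=> r; rewrite in_itv/= => /andP[r0 _]; exact: mollifier_D1_le0.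
- by move=> r; exact: mollifier_ge0.
have cg : continuous (fun x : R => - 'D_(1, 0) phi (x, 0) * (pi * x ^+ 2)).
  move=> x; apply: cvgM; first by apply: cvgN; exact: cdh.
  by apply: cvgM; [exact: cvg_cst|exact: exprn_continuous].
have [G [G0 dG]] := antiderivative cg.
rewrite (integral_is_derive ler01 dG); last exact: continuous_subspaceT.
rewrite G0 subr0 => G1.
rewrite (integral_is_derive (F := fun x => G x + pi * x ^+ 2 * phi (x, 0)))//.
- rewrite G0 ax// -G1; congr EFin; ring.
- move=> x x01; have dGx := dG x x01; have dhx := dh x.
  by apply: is_derive_eq; rewrite /GRing.scale/=; ring.
- apply: continuous_subspaceT => x; apply: cvgM.
    by apply: cvgM; [exact: cvg_cst|exact: cvg_id].
  by apply: cvgM; [exact: cvg_cst|exact: ch].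
Qed.

Lemma Cconst_lower (p : \bar R) : (1 <= p)%E -> 2 / 3 <= tau p <= 1 ->
  ((2 / pi * (4 / (tau p + 2)) `^ (tau p)^-1)%:E <= Cconst p phi)%E.
Proof.
move=> p1 t231; have /andP[t23 t1] := t231; have t0 : 0 < tau p by lra.
rewrite (CconstE p1 t0 ltr01 (mollifier_eq0 mphi)).
set t := tau p in t231 t23 t1 t0 *; clear p1.
have p0 : 0 < pi :> R := pi_gt0 R.
have cP : continuous (fun x => pi * phi (x, 0)).
  move=> x; apply: cvgM; first exact: cvg_cst.
  exact: (@continuous_slice1 _ phi 0 (mollifier_continuous mphi)).
have P0 (x : R) : 0 <= pi * phi (x, 0).
  by rewrite mulr_ge0 ?(ltW p0)//; exact: mollifier_ge0.
have Pdecr (x y : R) : 0 <= x -> x <= y -> pi * phi (y, 0) <= pi * phi (x, 0).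
  move=> x0 xy; rewrite ler_pM2l//; apply: (mollifier_nincr mphi).
  by rewrite !enorm_axis// (le_trans x0).
have -> : 2 / pi * (4 / (t + 2)) `^ t^-1 =
    (2 * ((2 / pi) `^ t * (2 / (t + 2)))) `^ t^-1.
  rewrite (_ : 2 * ((2 / pi) `^ t * (2 / (t + 2))) = (2 / pi) `^ t * (4 / (t + 2))); last by field; lra.
  rewrite powRM ?powR_ge0// ?divr_ge0//; last lra.
  rewrite -powRrM divff ?gt_eqF// powRr1// divr_ge0// ltW//.
rewrite -poweR_EFin; apply: gt0_ler_poweR.
- by rewrite invr_ge0 ltW.
- by rewrite in_itv/= leey andbT lee_fin !mulr_ge0 ?powR_ge0 ?invr_ge0//; lra.
- rewrite in_itv/= leey andbT mule_ge0// integral_ge0// => x _.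
  by rewrite lee_fin powR_ge0.
have lb := integral_powR_profile t231 cP P0 Pdecr integral_profile.
rewrite EFinM lee_pmul2l// EFinM.
apply: (@le_trans _ _ (((2 / pi) `^ t)%:E * \int[mu]_(x in `[0%R, 1%R])
    (x `^ (t / 2) * (pi * phi (x, 0%R)) `^ t)%:E)%E).
  by rewrite lee_pmul2l// lte_fin powR_gt0// divr_gt0.
have mw : measurable_fun setT (fun x => x `^ (t / 2) * (pi * phi (x, 0)) `^ t).
  apply: measurable_funM; first exact: measurable_powR.
  apply: (measurableT_comp (measurable_powR t)).
  exact: continuous_measurable_fun.
rewrite -ge0_integralZl//=; last 3 first.
- by apply/measurable_EFinP; exact: measurable_funTS.
- by move=> x _; rewrite lee_fin mulr_ge0 ?powR_ge0.
- by rewrite lee_fin powR_ge0.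
apply: ge0_le_integral => //.
- by move=> x _; rewrite -EFinM lee_fin !mulr_ge0 ?powR_ge0.
- apply/measurable_EFinP; apply: measurable_funM => //.
  exact: measurable_funTS.
- apply/measurable_EFinP; apply: measurable_funTS.
  apply: (measurableT_comp (measurable_powR (t / 2))).
  apply: continuous_measurable_fun => x; apply: cvgN; apply: cvgM.
    exact: continuous_mollifier_marginal.
  exact: continuous_mollifier_dmarginal.
move=> x; rewrite /= in_itv/= => /andP[x0 x1].
rewrite -EFinM lee_fin.
have -> : (2 / pi) `^ t * (x `^ (t / 2) * (pi * phi (x, 0)) `^ t) =
    (4 * x * phi (x, 0) ^+ 2) `^ (t / 2).
  have sq u : 0 <= u -> u `^ t = (u ^+ 2) `^ (t / 2).
    by move=> u0; rewrite -powR_mulrn// -powRrM; congr (_ `^ _); field.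
  have phi0 := mollifier_ge0 mphi (x, 0).
  have pi0 := ltW p0; have ipi0 : 0 <= pi^-1 :> R by rewrite invr_ge0.
  rewrite !sq ?divr_ge0 ?(ltW p0)// -!powRM ?mulr_ge0 ?sqr_ge0//.
  by congr (_ `^ _); field; lra.
have [->|xn0] := eqVneq x 0.
  by rewrite mulr0 mul0r powR0 ?powR_ge0// gt_eqF// divr_gt0.
have xp : 0 < x by rewrite lt0r xn0.
apply: ge0_ler_powR; rewrite ?nnegrE.
- by rewrite divr_ge0// ltW.
- apply: mulr_ge0; last exact: sqr_ge0.
  by rewrite mulr_ge0.
- rewrite oppr_ge0; apply: mulr_ge0_le0; first exact: marginal_ge0.
  exact: dmarginal_le0.
- exact: marginal_dmarginal_ge.
Qed.

End Cconst_of_mollifier.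

(** * A smooth function flat at the origin *)

(** The difference quotients at 0 are bounded by [C * |h|]. *)
Lemma is_derive0_of_sqr (R : realType) (f : R -> R) (C : R) :
  (forall h, `|f h| <= C * h ^+ 2) -> is_derive (0 : R) 1 f 0.
Proof.
move=> fC; have f0 : f 0 = 0.
  by apply/eqP; rewrite -normr_le0 (le_trans (fC 0))// expr0n mulr0.
have C0 : 0 <= C by have := fC 1; rewrite expr1n mulr1; exact: le_trans.
have c : (fun h : R => h^-1 *: (f (h *: 1 + 0) - f 0)) @ 0^' --> (0 : R).
  apply/cvgrPdist_le => e e0; near=> h.
  have hn0 : h != 0 by near: h; exact: nbhs_dnbhs_neq.
  rewrite f0 subr0 sub0r normrN addr0 /GRing.scale/= mulr1 normrM normfV.
  rewrite ler_pdivrMl ?normr_gt0// (le_trans (fC h))// -real_normK ?num_real//.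
  rewrite expr2 mulrCA ler_wpM2l//.
  apply: (@le_trans _ _ (C * (e / (C + 1)))).
    rewrite ler_wpM2l//; near: h; apply: dnbhs0_le.
    by rewrite divr_gt0// ltr_wpDl.
  by rewrite mulrCA ger_pMr// ler_pdivrMr ?mul1r ?lerDl// ltr_wpDl.
split; first by apply/cvg_ex; exists 0; exact: c.
by apply/cvg_lim; [exact: Rhausdorff|exact: c].
Unshelve. all: by end_near. Qed.

(** The functions [u^k exp(-u)] of [u = 1 / t], extended by 0. The linear span of this
    family is stable under derivation, which makes each member smooth. *)
Definition flat (R : realType) (k : nat) (t : R) : R :=
  if 0 < t then t^-1 ^+ k * expR (- t^-1) else 0.

Section flat.
Variable R : realType.
Implicit Types t : R.

Lemma flat_ge0 k t : 0 <= flat k t.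
Proof.
by rewrite /flat; case: ltP => // t0; rewrite mulr_ge0 ?expR_ge0// exprn_ge0// invr_ge0 ltW.
Qed.

(** From [exp u >= u ^+ (k + 2) / (k + 2)`!] with [u = 1 / t]. This is what makes all
    these functions derivable at 0. *)
Lemma flat_le_sqr k t : `|flat k t| <= k.+2`!%:R * t ^+ 2.
Proof.
rewrite ger0_norm ?flat_ge0// /flat; case: ltP => t0; last first.
  by rewrite mulr_ge0 ?sqr_ge0.
have u0 : 0 < t^-1 by rewrite invr_gt0.
rewrite expRN ler_pdivrMr ?expR_gt0//.
have := expR_ge1Dxn k.+1 (ltW u0).
have -> : k.+2`!%:R * t ^+ 2 * expR t^-1 = k.+2`!%:R * (t ^+ 2 * expR t^-1) by ring.
have kf : 0 < k.+2`!%:R :> R by rewrite ltr0n fact_gt0.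
move=> h; rewrite -ler_pdivrMl//.
have -> : k.+2`!%:R^-1 * t^-1 ^+ k = t ^+ 2 * (t^-1 ^+ k.+2 / k.+2`!%:R).
  by rewrite (exprS _ k.+1) (exprS _ k); field; rewrite !lt0r_neq0.
by rewrite ler_wpM2l ?sqr_ge0// (le_trans _ h)// lerDr.
Qed.

Lemma is_derive_flat k t :
  is_derive t 1 (@flat R k) (flat k.+2 t - k%:R * flat k.+1 t).
Proof.
have [t0|t0|<-] := ltgtP 0 t.
- have -> : flat k.+2 t - k%:R * flat k.+1 t =
      (t^-1 ^+ k.+2 - k%:R * t^-1 ^+ k.+1) * expR (- t^-1).
    by rewrite /flat t0; ring.
  apply: (@near_eq_is_derive _ _ _ (fun t => t^-1 ^+ k * expR (- t^-1))).
    by near=> s; rewrite /flat ifT//; near: s; exact: lt_nbhsr.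
  have tn0 : t != 0 by exact: lt0r_neq0.
  have dV : is_derive t 1 (fun t : R => t^-1) (- t ^- 2).
    by apply: (is_derive_eq (is_deriveV tn0 (is_derive_id _ _))); rewrite /GRing.scale/= mulr1.
  have dE : is_derive t 1 (fun t => expR (- t^-1)) (expR (- t^-1) * t ^- 2).
    apply: (@is_derive1_comp _ expR (fun t => - t^-1)).
    by apply: is_derive_eq; rewrite opprK.
  have dX : is_derive t 1 (fun t : R => t^-1 ^+ k) (k%:R * t^-1 ^+ k.-1 * (- t ^- 2)).
    have := @is_deriveX _ _ (fun t : R => t^-1) k t 1 _ dV.
    by rewrite exprfctE.
  apply: is_derive_eq; rewrite /GRing.scale/=.
  have -> : k%:R * t^-1 ^+ k.-1 = k%:R * t^-1 ^+ k * t :> R.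
    by case: (k) => [|n]; [rewrite !mul0r|rewrite exprS /=; field].
  by rewrite (exprS _ k.+1) (exprS _ k); field.
- have -> : flat k.+2 t - k%:R * flat k.+1 t = 0.
    by rewrite /flat ltNge (ltW t0)/= mulr0 subr0.
  apply: (@near_eq_is_derive _ _ _ (fun=> 0)).
    near=> s; rewrite /flat ltNge (_ : s <= 0 = true)//.
    by apply/ltW; near: s; exact: lt_nbhsl.
- rewrite /flat ltxx mulr0 subr0.
  exact: is_derive0_of_sqr (flat_le_sqr k).
Unshelve. all: by end_near.
Qed.

Lemma continuous_flat k : continuous (@flat R k).
Proof. by move=> t; exact: is_derive1_continuous (is_derive_flat k t). Qed.

End flat.

(** * Smooth mollifiers close to the indicator of a disk *)

Lemma is_derive_line (R : realType) (f : R * R -> R) (z v : R * R) (d : R) :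
  is_derive (0 : R) 1 (fun h => f (h *: v + z)) d -> is_derive z v f d.
Proof.
move=> [df dE]; split; first by apply/derivable1P.
rewrite -dE /derive.
have -> // : (fun h : R => h^-1 *: (f (h *: v + z) - f z)) = (fun h : R =>
    h^-1 *: (f ((h *: (1 : R) + 0) *: v + z) - f (0 *: v + z))).
by apply/funext => h; rewrite addr0 scale0r add0r /GRing.scale/= mulr1.
Qed.

Section bump_class.
Variables (R : realType) (a b : R).
Implicit Types (f g : R * R -> R) (z v : R * R).

(** A class of functions of the plane that contains the radial functions wanted and is
    stable under every directional derivative: differentiating a function of
    [a - b * |z| ^+ 2] produces a factor linear in the coordinates. *)
Inductive bump_class : (R * R -> R) -> Prop :=
| bump_base k : bump_class (fun z => flat k (a - b * (z.1 ^+ 2 + z.2 ^+ 2)))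
| bump_add f g : bump_class f -> bump_class g -> bump_class (fun z => f z + g z)
| bump_scale (c : R) f : bump_class f -> bump_class (fun z => c * f z)
| bump_fst f : bump_class f -> bump_class (fun z => z.1 * f z)
| bump_snd f : bump_class f -> bump_class (fun z => z.2 * f z).

Lemma continuous_coord1 : continuous (fun z => z.1).
Proof. by move=> z; exact: cvg_fst. Qed.

Lemma continuous_coord2 : continuous (fun z => z.2).
Proof. by move=> z; exact: cvg_snd. Qed.

Lemma bump_continuous f : bump_class f -> continuous f.
Proof.
elim=> {f} [k|f g _ cf _ cg|c f _ cf|f _ cf|f _ cf] z.
- apply: (@continuous_comp _ _ _ (fun z => a - b * (z.1 ^+ 2 + z.2 ^+ 2)) (flat k)).
    apply: cvgB; first exact: cvg_cst.
    apply: cvgM; first exact: cvg_cst.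
    apply: cvgD; apply: cvgM.
    + exact: continuous_coord1.
    + exact: continuous_coord1.
    + exact: continuous_coord2.
    + exact: continuous_coord2.
  exact: continuous_flat.
- by apply: cvgD; [exact: cf|exact: cg].
- by apply: cvgM; [exact: cvg_cst|exact: cf].
- by apply: cvgM; [exact: continuous_coord1|exact: cf].
- by apply: cvgM; [exact: continuous_coord2|exact: cf].
Qed.

Lemma is_derive_fst z v : is_derive z v (fun w => w.1) v.1.
Proof.
apply: is_derive_line => /=.
by apply: is_derive_eq; rewrite /GRing.scale/=; ring.
Qed.

Lemma is_derive_snd z v : is_derive z v (fun w => w.2) v.2.
Proof.
apply: is_derive_line => /=.
by apply: is_derive_eq; rewrite /GRing.scale/=; ring.
Qed.

Lemma bump_derive f v : bump_class f ->
  exists2 df, bump_class df & forall z, is_derive z v f (df z).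
Proof.
elim=> {f} [k|f g _ [df bdf fdf] _ [dg bdg gdg]|c f _ [df bdf fdf]|
    f bf [df bdf fdf]|f bf [df bdf fdf]].
- pose q k := fun z => flat k (a - b * (z.1 ^+ 2 + z.2 ^+ 2)).
  pose e := fun z => q k.+2 z + - k%:R * q k.+1 z.
  have be : bump_class e.
    by apply: bump_add; [exact: bump_base|apply: bump_scale; exact: bump_base].
  exists (fun z => - (2 * b * v.1) * (z.1 * e z) + - (2 * b * v.2) * (z.2 * e z)).
    by apply: bump_add; apply: bump_scale; [exact: bump_fst|exact: bump_snd].
  move=> z; apply: is_derive_line.
  pose l (h : R) := a - b * ((h *: v + z).1 ^+ 2 + (h *: v + z).2 ^+ 2).
  have dl : is_derive (0 : R) 1 l (- b * (2 * z.1 * v.1 + 2 * z.2 * v.2)).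
    have -> : l = (fun h : R => a - b * ((h * v.1 + z.1) ^+ 2 + (h * v.2 + z.2) ^+ 2)).
      by [].
    by apply: is_derive_eq; rewrite /GRing.scale/=; ring.
  have := @is_derive1_comp _ (flat k) l 0 _ _ (is_derive_flat k (l 0)) dl.
  have l0 : l 0 = a - b * (z.1 ^+ 2 + z.2 ^+ 2) by rewrite /l scale0r add0r.
  rewrite l0 /e /q => h.
  apply: is_derive_eq. by ring.
- exists (fun z => df z + dg z); first exact: bump_add.
  by move=> z; apply: is_deriveD.
- exists (fun z => c * df z); first exact: bump_scale.
  by move=> z; apply: is_deriveZ.
- exists (fun z => v.1 * f z + z.1 * df z).
    by apply: bump_add; [exact: bump_scale|exact: bump_fst].
  move=> z; have d1 := is_derive_fst z v; have d2 := fdf z.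
  by apply: is_derive_eq; rewrite /GRing.scale/=; ring.
- exists (fun z => v.2 * f z + z.2 * df z).
    by apply: bump_add; [exact: bump_scale|exact: bump_snd].
  move=> z; have d1 := is_derive_snd z v; have d2 := fdf z.
  by apply: is_derive_eq; rewrite /GRing.scale/=; ring.
Qed.

(** Induction on the order: the partial derivatives are again in the class. *)
Lemma bump_smooth f : bump_class f -> smooth f.
Proof.
move=> bf n; elim: n f bf => [|n IH] f bf.
  by split=> //; exact: bump_continuous.
split; first exact: bump_continuous.
have dv v : bump_class ('D_v f) /\ forall z, derivable f z v.
  have [df bdf fdf] := bump_derive v bf.
  have -> : 'D_v f = df by apply/funext => z; have [] := fdf z.
  by split=> // z; have [] := fdf z.
by split; [exact: (dv _).2|exact: (dv _).2|apply: IH; exact: (dv _).1..].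
Qed.

End bump_class.

Lemma continuous_enorm (R : realType) : continuous (@enorm R).
Proof.
move=> z; apply: (@continuous_comp _ _ _ (fun z : R * R => z.1 ^+ 2 + z.2 ^+ 2) Num.sqrt).
  apply: cvgD; apply: cvgM.
  - exact: continuous_coord1.
  - exact: continuous_coord1.
  - exact: continuous_coord2.
  - exact: continuous_coord2.
exact: sqrt_continuous.
Qed.

Lemma flat0_le1 (R : realType) (t : R) : flat 0 t <= 1.
Proof.
rewrite /flat; case: ltP => // t0; rewrite expr0 mul1r.
by rewrite -expR0 ler_expR oppr_le0 invr_ge0 ltW.
Qed.

(** [exp (- 1 / t) >= 1 - 1 / t]. *)
Lemma flat0_ge (R : realType) (e t : R) : 0 < e -> e^-1 <= t -> 1 - e <= flat 0 t.
Proof.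
move=> e0 et; have t0 : 0 < t by rewrite (lt_le_trans _ et)// invr_gt0.
rewrite /flat t0 expr0 mul1r (le_trans _ (expR_ge1Dx _))// lerD2l lerN2.
by rewrite -[leRHS]invrK lef_pV2 ?posrE// invr_gt0.
Qed.

Lemma flat0_nondecreasing (R : realType) (s t : R) : s <= t -> flat 0 s <= flat 0 t.
Proof.
move=> st; rewrite /flat; case: (ltP 0 s) => s0; last first.
  by case: ltP => // t0; rewrite expr0 mul1r expR_ge0.
have t0 : 0 < t by exact: lt_le_trans st.
by rewrite t0 !expr0 !mul1r ler_expR lerN2 lef_pV2.
Qed.

(** Normalize [flat 0 ((1 - |z| ^+ 2 / b ^+ 2) / e ^+ 2)]. This function lies between 0
    and 1, vanishes outside the disk of radius [b], and is at least [1 - e] where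
    [|z| ^+ 2 <= b ^+ 2 * (1 - e)]. Its integral is therefore between
    [(1 - e) ^+ 2 * pi * b ^+ 2] and [pi * b ^+ 2]. *)
Lemma concentrated_mollifier (R : realType) (e b : R) :
  0 < e <= 2^-1 -> 0 < b <= 1 -> exists phi, [/\ mollifier R phi,
    forall z, b <= enorm z -> phi z = 0,
    forall z, phi z <= (1 + 6 * e) / (pi * b ^+ 2) &
    forall z, enorm z ^+ 2 <= b ^+ 2 * (1 - e) -> (1 - e) / (pi * b ^+ 2) <= phi z].
Proof.
move=> /andP[e0 e2] /andP[b0 b1].
have p0 : 0 < pi :> R := pi_gt0 R.
have b20 : 0 < b ^+ 2 by rewrite exprn_gt0.
have e20 : 0 < e ^+ 2 by rewrite exprn_gt0.
pose B := (b ^+ 2 * e ^+ 2)^-1.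
have B0 : 0 < B by rewrite invr_gt0 mulr_gt0.
(* [A - B * |z| ^+ 2 = (1 - |z| ^+ 2 / b ^+ 2) / e ^+ 2]; on the disk where
   [|z| ^+ 2 <= b ^+ 2 * (1 - e)] this is at least [e^-1]. *)
pose A := e ^- 2.
pose g (z : R * R) := flat 0 (A - B * (z.1 ^+ 2 + z.2 ^+ 2)).
have nE (z : R * R) : z.1 ^+ 2 + z.2 ^+ 2 = enorm z ^+ 2.
  by rewrite /enorm sqr_sqrtr// addr_ge0// sqr_ge0.
have gE z : g z = flat 0 (A - B * enorm z ^+ 2) by rewrite /g nE.
have g0 z : 0 <= g z by exact: flat_ge0.
have g1 z : g z <= 1 by exact: flat0_le1.
have gb z : b <= enorm z -> g z = 0.
  move=> bz; rewrite gE /flat ltNge (_ : _ <= 0 = true)//.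
  rewrite subr_le0 (_ : A = B * b ^+ 2); last by rewrite /A /B; field; lra.
  by rewrite ler_pM2l// ler_pXn2r ?nnegrE// ?(ltW b0)// enorm_ge0.
have gm z : enorm z ^+ 2 <= b ^+ 2 * (1 - e) -> 1 - e <= g z.
  move=> bz; rewrite gE; apply: flat0_ge => //.
  have : B * enorm z ^+ 2 <= B * (b ^+ 2 * (1 - e)) by rewrite ler_pM2l.
  have -> : B * (b ^+ 2 * (1 - e)) = A - e^-1 by rewrite /A /B; field; lra.
  lra.
pose T := measurableTypeR R.
have mrho : measurable_fun setT (fun z : T * T => z.1 ^+ 2 + z.2 ^+ 2 : R).
  by apply: measurable_funD; apply: measurable_funX.
have mg : measurable_fun setT (g : T * T -> R).
  apply: (@measurableT_comp _ _ _ _ _ _ (flat 0 : R -> R) _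
      (fun z : T * T => A - B * (z.1 ^+ 2 + z.2 ^+ 2))).
    by apply: continuous_measurable_fun; exact: continuous_flat.
  by apply: measurable_funB => //; apply: measurable_funM.
have mD r : measurable [set z : T * T | z.1 ^+ 2 + z.2 ^+ 2 < r ^+ 2].
  rewrite [X in measurable X](_ : _ = [set: T * T] `&`
      (fun z : T * T => z.1 ^+ 2 + z.2 ^+ 2 < r ^+ 2) @^-1` [set true]).
    by apply: (measurable_fun_ltr mrho) => //.
  by rewrite setTI.
have iD (r : R) : 0 < r -> (\int[@lebesgue_measure R \x @lebesgue_measure R]_z
    (\1_[set z : T * T | z.1 ^+ 2 + z.2 ^+ 2 < r ^+ 2] z)%:E)%E = (pi * r ^+ 2)%:E.
  by move=> r0; rewrite integral_indic// setIT -(disk_area r0).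
pose I := (\int[@lebesgue_measure R \x @lebesgue_measure R]_z (g z)%:E)%E.
have Iu : (I <= (pi * b ^+ 2)%:E)%E.
  rewrite -iD//; apply: ge0_le_integral => //.
  - by move=> z _; rewrite lee_fin.
  - exact/measurable_EFinP.
  - by apply/measurable_EFinP; exact: measurable_indic.
  - move=> z _; rewrite lee_fin indicE; case: (boolP (z \in _)) => //.
    rewrite notin_setE/= nE => /negP; rewrite -leNgt ler_pXn2r ?nnegrE ?enorm_ge0 ?(ltW b0)//.
    by move=> /gb ->.
have Il : (((1 - e) * (pi * (b ^+ 2 * (1 - e))))%:E <= I)%E.
  have s0 : 0 < 1 - e by lra.
  have sE : (b * Num.sqrt (1 - e)) ^+ 2 = b ^+ 2 * (1 - e).
    by rewrite exprMn sqr_sqrtr// ltW.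
  rewrite EFinM -sE -iD ?mulr_gt0 ?sqrtr_gt0// -ge0_integralZl//=; last 2 first.
  - by apply/measurable_EFinP; exact: measurable_indic.
  - by rewrite lee_fin ltW.
  apply: ge0_le_integral => //.
  - by move=> z _; rewrite -EFinM lee_fin mulr_ge0// ltW.
  - apply/measurable_EFinP; apply: measurable_funM => //; exact: measurable_indic.
  - exact/measurable_EFinP.
  - move=> z _; rewrite -EFinM lee_fin indicE; case: (boolP (z \in _)).
      by rewrite inE/= nE sE mulr1 => /ltW/gm.
    by rewrite mulr0.
have k0 : 0 < (1 - e) * (pi * (b ^+ 2 * (1 - e))).
  by rewrite !mulr_gt0//; lra.
have I0 : (0 <= I)%E by apply: integral_ge0 => z _; rewrite lee_fin.
have IJ : I = (fine I)%:E by rewrite fineK// ge0_fin_numE// (le_lt_trans Iu)// ltry.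
set J := fine I in IJ.
rewrite IJ !lee_fin in Iu Il.
have J0 : 0 < J by exact: lt_le_trans Il.
exists (fun z => J^-1 * g z).
have Ju : J^-1 <= (1 + 6 * e) / (pi * b ^+ 2).
  have pb : 0 < pi * b ^+ 2 by rewrite mulr_gt0.
  rewrite ler_pdivlMr// mulrC ler_pdivrMr//.
  apply: (@le_trans _ _ ((1 + 6 * e) * ((1 - e) * (pi * (b ^+ 2 * (1 - e)))))).
    rewrite (_ : (1 + 6 * e) * ((1 - e) * (pi * (b ^+ 2 * (1 - e)))) = (1 + 6 * e) * (1 - e) ^+ 2 * (pi * b ^+ 2)); last by ring.
    rewrite ler_peMl ?(ltW pb)//.
    rewrite (_ : (1 + 6 * e) * (1 - e) ^+ 2 = 1 + e * ((1 - 2 * e) * (4 - 3 * e))).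
      by rewrite lerDl !mulr_ge0//; lra.
    by ring.
  by rewrite ler_wpM2l//; lra.
have Jl : (pi * b ^+ 2)^-1 <= J^-1.
  by rewrite lef_pV2// posrE mulr_gt0.
split.
- split; split.
  + by apply/bump_smooth; apply: bump_scale; exact: bump_base.
  + by move=> z w zw; rewrite !gE zw.
  + by move=> z; rewrite mulr_ge0// invr_ge0 ltW.
  + have cl : closed [set z : R * R | enorm z <= 1].
      apply: (@closed_comp _ _ (@enorm R) [set x : R | x <= 1]) => //.
      move=> z _; exact: continuous_enorm.
    rewrite [X in _ `<=` X](closure_id _).1//; apply: closure_subset => z /=.
    move=> gz; rewrite leNgt; apply/negP => z1; move/eqP: gz; apply.
    by rewrite gb ?mulr0// ltW// (le_lt_trans b1).
  + under eq_integral do rewrite EFinM.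
    rewrite ge0_integralZl//=; last 3 first.
    * exact/measurable_EFinP.
    * by move=> z _; rewrite lee_fin.
    * by rewrite lee_fin invr_ge0 ltW.
    by rewrite -/I IJ -EFinM mulVf// gt_eqF.
  + move=> z w zw; rewrite ler_pM2l ?invr_gt0// !gE flat0_nondecreasing//.
    by rewrite lerD2l lerN2 ler_pM2l// ler_pXn2r ?nnegrE// sqrtr_ge0.
- by move=> z bz; rewrite gb// mulr0.
- by move=> z; rewrite (le_trans _ Ju)// ler_piMr// invr_ge0 ltW.
- move=> z /gm gz; rewrite mulrC; apply: ler_pM => //; last by lra.
  by rewrite invr_ge0 ltW// mulr_gt0.
Qed.

(** * Upper bounds by tangents of the power function *)

(** A concave function is below its tangent at [k]; this is Young's inequality for
    the exponents [1 / s] and [1 / (1 - s)], applied to [(u / k) `^ s] and 1. *)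
Lemma powR_tangent (R : realType) (s u k : R) : 0 < s < 1 -> 0 <= u -> 0 < k ->
  u `^ s <= (1 - s) * k `^ s + s * k `^ (s - 1) * u.
Proof.
move=> /andP[s0 s1] u0 k0.
have w0 : 0 <= u / k by rewrite divr_ge0// ltW.
have := @conjugate_powR _ ((u / k) `^ s) 1 s^-1 (1 - s)^-1 (powR_ge0 _ _) ler01.
rewrite !invr_gt0 subr_gt0 !invrK => /(_ s0 s1 (subrKC _ _)).
rewrite mulr1 -powRrM divff ?gt_eqF// powRr1// powR1 mul1r => h.
have -> : u `^ s = k `^ s * (u / k) `^ s.
  by rewrite -powRM ?(ltW k0)// mulrCA divff ?gt_eqF// mulr1.
have -> : (1 - s) * k `^ s + s * k `^ (s - 1) * u = k `^ s * (u / k * s + (1 - s)).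
  by rewrite -(mulr_powRB1 (ltW k0) s0); field; lra.
by rewrite ler_wpM2l ?powR_ge0.
Qed.

Section upper.
Variables (R : realType) (phi : R * R -> R) (mphi : mollifier R phi).
Notation mu := (@lebesgue_measure R).
Let K x := - (marginal phi x * dmarginal phi x).

Let K_ge0 x : 0 <= x -> 0 <= K x.
Proof.
move=> x0; rewrite oppr_ge0 mulr_ge0_le0 ?marginal_ge0//.
exact: dmarginal_le0.
Qed.

Let mK s : measurable_fun setT (fun x => K x `^ s).
Proof.
apply: (measurableT_comp (measurable_powR s)).
apply: continuous_measurable_fun => x; apply: cvgN; apply: cvgM.
  exact: continuous_mollifier_marginal.
exact: continuous_mollifier_dmarginal.
Qed.

Let cK : continuous K.
Proof.
move=> x; apply: cvgN; apply: cvgM.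
  exact: continuous_mollifier_marginal.
exact: continuous_mollifier_dmarginal.
Qed.

Let dsqr (x : R) : is_derive x 1 (fun x => marginal phi x ^+ 2) (- 2 * K x).
Proof.
have d := is_derive_mollifier_marginal mphi x.
by apply: is_derive_eq; rewrite /GRing.scale/= /K; ring.
Qed.

(** Tangent at a constant, that is, Jensen's inequality on [[0, b]]: the mean of
    [K = - Phi Phi'] is at most [Phi 0 ^+ 2 / (2 * b)]. *)
Lemma integral_powR_le_const (s k b : R) : 0 < s < 1 -> 0 < k -> 0 < b ->
  marginal phi 0 ^+ 2 <= 2 * b * k ->
  (\int[mu]_(x in `[0%R, b]) (K x `^ s)%:E <= (k `^ s * b)%:E)%E.
Proof.
move=> s01 k0 b0 G0; have /andP[s0 s1] := s01.
(* A primitive of the tangent at [k], since [(Phi ^+ 2)' = - 2 * K]. *)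
pose Q x := (1 - s) * k `^ s * x - s / 2 * k `^ (s - 1) * marginal phi x ^+ 2.
apply: (@le_trans _ _ (Q b - Q 0)%:E).
  apply: (@integral_le_increment _ _ _
    (fun x => (1 - s) * k `^ s + s * k `^ (s - 1) * K x)).
  - exact: ltW.
  - move=> x _; have d := dsqr x; rewrite /Q.
    by apply: is_derive_eq; rewrite /GRing.scale/=; field.
  - apply: continuous_subspaceT => x; apply: cvgD; first exact: cvg_cst.
    by apply: cvgM; [exact: cvg_cst|exact: cK].
  - exact: mK.
  - by move=> x; exact: powR_ge0.
  - move=> x; rewrite in_itv/= => /andP[x0 _]; apply: powR_tangent => //.
    exact: K_ge0.
rewrite lee_fin /Q.
have w0 : 0 <= k `^ (s - 1) by exact: powR_ge0.
have := mulr_powRB1 (ltW k0) s0 => <-.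
have Gb : 0 <= marginal phi b ^+ 2 by exact: sqr_ge0.
have h1 : s / 2 * k `^ (s - 1) * marginal phi 0 ^+ 2 <= s / 2 * k `^ (s - 1) * (2 * b * k).
  by rewrite ler_wpM2l// mulr_ge0//; lra.
have h2 : 0 <= s / 2 * k `^ (s - 1) * marginal phi b ^+ 2.
  by apply: (mulr_ge0 _ Gb); apply: (mulr_ge0 _ w0); lra.
by lra.
Qed.

(** Here [Phi ^+ 2] is within [e] of [k * (1 - x ^+ 2)], for which [- Phi Phi'] would be
    [k * x]. The tangent is taken at [k * (x + d)]: the shift [d] keeps the weight
    [(k * (x + d)) `^ (s - 1)] bounded near 0. The error term, the integral of the
    weight against the derivative of [Phi ^+ 2 - k * (1 - x ^+ 2)], is integrated by
    parts, so that only the bound [e] enters; the weight being monotone, its total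
    variation is at most its value at 0. *)
Lemma integral_powR_le_linear (s k d e : R) : 0 < s < 1 -> 0 < k -> 0 < d ->
  {in `[0, 1], forall x, `|marginal phi x ^+ 2 - k * (1 - x ^+ 2)| <= e} ->
  (\int[mu]_(x in `[0%R, 1%R]) (K x `^ s)%:E <=
   (k `^ s * (1 + d) `^ (s + 1) / (s + 1) + s * e * (k * d) `^ (s - 1))%:E)%E.
Proof.
move=> s01 k0 d0 Ge; have /andP[s0 s1] := s01.
pose E x := marginal phi x ^+ 2 - k * (1 - x ^+ 2).
pose l x := k * (x + d).
pose Q x := k `^ s * (x + d) `^ (s + 1) / (s + 1) - s / 2 * (l x `^ (s - 1) * (E x + e)).
pose dQ x := l x `^ s - s / 2 * ((s - 1) * l x `^ (s - 1 - 1) * k * (E x + e)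
   + l x `^ (s - 1) * (- 2 * K x + 2 * k * x)).
have l0 x : 0 <= x -> 0 < l x by move=> x0; rewrite mulr_gt0// ltr_wpDl.
have dl (x : R) : is_derive x 1 l k.
  by rewrite /l; apply: is_derive_eq; rewrite /GRing.scale/=; ring.
have dlp (r x : R) : 0 <= x -> is_derive x 1 (fun x => l x `^ r) (r * l x `^ (r - 1) * k).
  move=> x0.
  exact: (@is_derive1_comp _ (fun y : R => y `^ r) l x _ _ (is_derive1_powR r (l0 x x0)) (dl x)).
have dE (x : R) : is_derive x 1 E (- 2 * K x + 2 * k * x).
  have dx := dsqr x; rewrite /E; apply: is_derive_eq; rewrite /GRing.scale/=; ring.
have dQE : {in `[0, 1], forall x : R, is_derive x 1 Q (dQ x)}.
  move=> x; rewrite in_itv/= => /andP[x0 x1].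
  have xd0 : 0 < x + d by rewrite ltr_wpDl.
  have d1 : is_derive x 1 (fun x => (x + d) `^ (s + 1)) ((s + 1) * (x + d) `^ (s + 1 - 1) * 1).
    apply: (@is_derive1_comp _ (fun y : R => y `^ (s + 1)) (fun x => x + d) x _ _ (is_derive1_powR (s + 1) xd0)).
    by apply: is_derive_eq; rewrite addr0.
  have d2 := dlp (s - 1) x x0; have d3 := dE x.
  rewrite /Q; apply: is_derive_eq; rewrite /GRing.scale/= /dQ.
  rewrite (_ : s + 1 - 1 = s); last by ring.
  have -> : l x `^ s = k `^ s * (x + d) `^ s by rewrite /l powRM ?(ltW k0) ?(ltW xd0).
  by field; lra.
apply: (@le_trans _ _ (Q 1 - Q 0)%:E).
  apply: (@integral_le_increment _ _ Q dQ).
  - exact: ler01.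
  - exact: dQE.
  - apply: continuous_in_subspaceT => x; rewrite inE/= in_itv/= => /andP[x0 x1].
    have cl r : {for x, continuous (fun x => l x `^ r)}.
      exact: is_derive1_continuous (dlp r x x0).
    have cE : {for x, continuous E} by exact: is_derive1_continuous (dE x).
    apply: cvgB; first exact: cl.
    apply: cvgM; first exact: cvg_cst.
    apply: cvgD; apply: cvgM.
    + by apply: cvgM; [apply: cvgM; [exact: cvg_cst|exact: cl]|exact: cvg_cst].
    + by apply: cvgD; [exact: cE|exact: cvg_cst].
    + exact: cl.
    + apply: cvgD; first by apply: cvgM; [exact: cvg_cst|exact: cK].
      by apply: cvgM; [exact: cvg_cst|exact: cvg_id].
  - exact: mK.
  - by move=> x; exact: powR_ge0.
  - move=> x; rewrite in_itv/= => /andP[x0 x1].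
    have Ex : 0 <= E x + e.
      have := Ge x; rewrite in_itv/= x0 x1 => /(_ isT).
      by rewrite ler_norml => /andP[h _]; rewrite -lerBlDr sub0r.
    have lx := l0 x x0.
    apply: (le_trans (powR_tangent s01 (K_ge0 x0) lx)).
    have h1 : (s - 1) * l x `^ (s - 1 - 1) * k * (E x + e) <= 0.
      rewrite mulr_le0_ge0// mulr_le0_ge0 ?(ltW k0)// mulr_le0_ge0 ?powR_ge0//; lra.
    have h2 : s * l x `^ (s - 1) * (k * x) <= s * l x `^ s.
      rewrite -(mulr_powRB1 (ltW lx) s0) -mulrA ler_wpM2l ?(ltW s0)// mulrC.
      by rewrite ler_wpM2r ?powR_ge0// /l ler_pM2l// lerDl ltW.
    have h3 : 0 <= s * (- ((s - 1) * l x `^ (s - 1 - 1) * k * (E x + e))).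
      by rewrite mulr_ge0 ?oppr_ge0// ltW.
    by rewrite /dQ; lra.
rewrite lee_fin /Q.
have E1 : 0 <= E 1 + e.
  have := Ge 1; rewrite in_itv/= ler01 lexx => /(_ isT).
  by rewrite ler_norml => /andP[h _]; rewrite -lerBlDr sub0r.
have E0 : E 0 <= e.
  have := Ge 0; rewrite in_itv/= ler01 lexx => /(_ isT).
  by rewrite ler_norml => /andP[].
have h1 : 0 <= s / 2 * (l 1 `^ (s - 1) * (E 1 + e)).
  by rewrite !mulr_ge0 ?powR_ge0//; lra.
have h2 : 0 <= k `^ s * (0 + d) `^ (s + 1) / (s + 1).
  by rewrite !mulr_ge0 ?powR_ge0// invr_ge0; lra.
have h3 : s / 2 * (l 0 `^ (s - 1) * (E 0 + e)) <= s * e * (k * d) `^ (s - 1).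
  rewrite /l add0r (_ : s * e * _ = s / 2 * ((k * d) `^ (s - 1) * (e + e))); last by field.
  by rewrite ler_wpM2l ?divr_ge0 ?(ltW s0)// ler_wpM2l ?powR_ge0// lerD2r.
by lra.
Qed.

End upper.

(** * The infimum of the constant *)

(** The section of a disk at abscissa [x] is an interval whose length is given by a
    square root, equal to 0 when the section is empty. *)
Lemma marginal_bounds (R : realType) (phi : R * R -> R) (M m b d x : R) :
  mollifier R phi -> 0 <= M -> 0 <= m -> 0 < b ->
  (forall z, phi z <= M) -> (forall z, b <= enorm z -> phi z = 0) ->
  (forall z, enorm z ^+ 2 <= d -> m <= phi z) ->
  2 * m * Num.sqrt (d - x ^+ 2) <= marginal phi x <= 2 * M * Num.sqrt (b ^+ 2 - x ^+ 2).
Proof.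
move=> mphi M0 m0 b0 phiM phib phim.
pose mu := @lebesgue_measure R.
have nE (y : R) : enorm (x, y) ^+ 2 = x ^+ 2 + y ^+ 2.
  by rewrite /enorm sqr_sqrtr// addr_ge0// sqr_ge0.
have mA (c : R) : measurable ([set y | y ^+ 2 < c] : set (measurableTypeR R)).
  rewrite [X in measurable X](_ : _ = [set: measurableTypeR R] `&`
      (fun y : measurableTypeR R => y ^+ 2 < c) @^-1` [set true]).
    by apply: measurable_fun_ltr => //; exact: measurable_funX.
  by rewrite setTI.
have iA (k c : R) : 0 <= k ->
    (\int[mu]_y (k * \1_[set y : measurableTypeR R | (y ^+ 2 < c)%R] y)%:E)%E =
    (2 * k * Num.sqrt c)%:E.
  move=> k0; under eq_integral do rewrite EFinM.
  rewrite ge0_integralZl//=; last by apply/measurable_EFinP; exact: measurable_indic.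
  by rewrite integral_indic// setIT [X in (_ * X)%E]lebesgue_sqr_lt -EFinM mulrCA mulrA.
have cp := @continuous_slice2 _ phi x (mollifier_continuous mphi).
have mphix : measurable_fun setT (fun y : measurableTypeR R => (phi (x, y))%:E).
  exact: (@continuous_emeasurable _ (fun y => phi (x, y))).
have p0 z := mollifier_ge0 mphi z.
have mI (k c : R) : measurable_fun setT (fun y : measurableTypeR R =>
    (k * \1_[set y : measurableTypeR R | (y ^+ 2 < c)%R] y)%:E).
  by apply/measurable_EFinP; apply: measurable_funM => //; exact: measurable_indic.
have up : (\int[mu]_y (phi (x, y))%:E <= (2 * M * Num.sqrt (b ^+ 2 - x ^+ 2))%:E)%E.
  rewrite -iA//; apply: ge0_le_integral => //.
  - by move=> y _; rewrite lee_fin.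
  - move=> y _; rewrite lee_fin indicE; case: (boolP (y \in _)).
      by rewrite mulr1.
    rewrite notin_setE/= ltrBrDl -nE => /negP; rewrite -leNgt => by2.
    rewrite phib ?mulr0//.
    by rewrite -(@ler_pXn2r _ 2)// nnegrE ?(ltW b0)// enorm_ge0.
have lo : ((2 * m * Num.sqrt (d - x ^+ 2))%:E <= \int[mu]_y (phi (x, y))%:E)%E.
  rewrite -iA//; apply: ge0_le_integral => //.
  - by move=> y _; rewrite lee_fin mulr_ge0.
  - move=> y _; rewrite lee_fin indicE; case: (boolP (y \in _)).
      by rewrite inE/= ltrBrDl -nE => /ltW/phim; rewrite mulr1.
    by rewrite mulr0.
have fin : (\int[mu]_y (phi (x, y))%:E)%E \is a fin_num.
  rewrite ge0_fin_numE; first exact: le_lt_trans up (ltry _).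
  by apply: integral_ge0 => y _; rewrite lee_fin.
have E : (marginal phi x)%:E = (\int[mu]_y (phi (x, y))%:E)%E by rewrite fineK.
by rewrite -!lee_fin E lo up.
Qed.

Lemma tau_bounds (R : realType) (p : \bar R) : (1 <= p)%E -> 0 < tau p <= 1.
Proof.
move=> p1; have := inv_tau p1; have ti : 1 <= (tau p)^-1.
  rewrite -lee_fin inv_tau// leeDl// inve_ge0.
  by apply: le_trans p1; rewrite lee_fin.
have i0 : 0 < (tau p)^-1 by exact: lt_le_trans ti.
by rewrite -invr_gt0 i0/= -[leRHS]invr1 -[leLHS]invrK lef_pV2// posrE.
Qed.

Lemma tau_ge23 (R : realType) (p : \bar R) : (1 <= p)%E ->
  (2 / 3 <= tau p) = (2%:E <= p)%E.
Proof.
move=> p1; have /andP[t0 _] := tau_bounds p1.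
have -> : (2 / 3 <= tau p) = ((tau p)^-1 <= 3 / 2).
  by rewrite -[in RHS]invf_div lef_pV2 ?posrE// divr_gt0.
have := inv_tau p1; case: p p1 t0 => [r|_|//].
- rewrite !lee_fin => r1 t0; have r0 : 0 < r by exact: lt_le_trans r1.
  rewrite inver gt_eqF// -EFinD => -[->].
  have -> : (1 + r^-1 <= 3 / 2) = (r^-1 <= 2^-1) by apply/idP/idP; lra.
  by rewrite lef_pV2// posrE.
- by move=> t0; rewrite invey adde0 leey => -[->]; rewrite ler_pdivlMr// mul1r ler_nat.
Qed.

Lemma lower_constant_powR (R : realType) (t : R) : 0 < t ->
  2 / pi * (4 / (t + 2)) `^ t^-1 =
  (2 * ((4 / pi ^+ 2) `^ (t / 2) / (t / 2 + 1))) `^ t^-1.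
Proof.
move=> t0; have p0 : 0 < pi :> R := pi_gt0 R.
have -> : 4 / pi ^+ 2 = (2 / pi) ^+ 2 :> R by field; lra.
have -> : ((2 / pi) ^+ 2) `^ (t / 2) = (2 / pi) `^ t :> R.
  rewrite -powR_mulrn ?divr_ge0 ?(ltW p0)// -powRrM; congr (_ `^ _).
  by field.
have -> : 2 * ((2 / pi) `^ t / (t / 2 + 1)) = (2 / pi) `^ t * (4 / (t + 2)).
  by field; lra.
rewrite powRM ?powR_ge0//; last by rewrite divr_ge0//; lra.
by rewrite -powRrM divff ?gt_eqF// powRr1// divr_ge0// ltW.
Qed.

Lemma Cconst_le_integral (R : realType) (p : \bar R) (phi : R * R -> R) (b V : R) :
  mollifier R phi -> (1 <= p)%E -> 0 < b -> (forall z, b <= enorm z -> phi z = 0) ->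
  (\int[@lebesgue_measure R]_(x in `[0%R, b])
    ((- (marginal phi x * dmarginal phi x)) `^ (tau p / 2))%:E <= V%:E)%E ->
  (Cconst p phi <= ((2 * V) `^ (tau p)^-1)%:E)%E.
Proof.
move=> mphi p1 b0 phib iV; have /andP[t0 _] := tau_bounds p1.
rewrite (CconstE mphi p1 t0 b0 phib) -poweR_EFin.
have I0 : (0 <= \int[@lebesgue_measure R]_(x in `[0%R, b])
    ((- (marginal phi x * dmarginal phi x)) `^ (tau p / 2))%:E)%E.
  by apply: integral_ge0 => x _; rewrite lee_fin powR_ge0.
apply: gt0_ler_poweR.
- by rewrite invr_ge0 ltW.
- by rewrite in_itv/= leey andbT mule_ge0.
- by rewrite in_itv/= leey andbT EFinM mule_ge0//; exact: le_trans iV.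
- by rewrite EFinM lee_pmul2l.
Qed.

(** With [k = 4 / pi ^+ 2], the bound of [integral_powR_le_linear] tends to half of [W]
    when the error on [Phi ^+ 2] and then the shift [d] tend to 0. The shift is
    chosen first, then the parameter [q] of the mollifier. *)
Lemma Cconst_upper (R : realType) (p : \bar R) (e : R) : (1 <= p)%E -> 0 < e ->
  exists2 phi, mollifier R phi &
  (Cconst p phi <= (2 / pi * (4 / (tau p + 2)) `^ (tau p)^-1 + e)%:E)%E.
Proof.
move=> p1 e0; have /andP[t0 t1] := tau_bounds p1.
have p0 : 0 < pi :> R := pi_gt0 R.
pose s := tau p / 2; have s01 : 0 < s < 1.
  by clear p1; rewrite /s; lra.
have /andP[s0 s1] := s01.
pose k : R := 4 / pi ^+ 2.
have k0 : 0 < k by rewrite divr_gt0// exprn_gt0.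
rewrite lower_constant_powR//.
pose W := 2 * (k `^ s / (s + 1)).
have W0 : 0 < W by rewrite mulr_gt0// divr_gt0 ?powR_gt0//; clear p1; lra.
have [rho rho0 Hrho] : exists2 rho, 0 < rho &
    (W + rho) `^ (tau p)^-1 <= W `^ (tau p)^-1 + e.
  have cW : {for W, continuous (fun u => u `^ (tau p)^-1)}.
    exact: is_derive1_continuous (is_derive1_powR _ W0).
  have /cvgrPdist_le/(_ e e0)[rho /= rho0 Hrho] := cW.
  exists (rho / 2); first by rewrite divr_gt0.
  have := Hrho (W + rho / 2).
  rewrite /= opprD addrA subrr sub0r normrN gtr0_norm ?divr_gt0//.
  rewrite ltr_pdivrMr// ltr_pMr// ltr1n => /(_ isT).
  by rewrite distrC ler_norml => /andP[_]; rewrite lerBlDl.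
suff [phi mphi [V [VW iV]]] : exists2 phi, mollifier R phi & exists V,
    2 * V <= W + rho /\
    (\int[@lebesgue_measure R]_(x in `[0%R, 1%R])
     ((- (marginal phi x * dmarginal phi x)) `^ (tau p / 2))%:E <= V%:E)%E.
  exists phi => //.
  have V0 : 0 <= V.
    rewrite -lee_fin; apply: le_trans iV; apply: integral_ge0 => x _.
    by rewrite lee_fin powR_ge0.
  apply: (le_trans (Cconst_le_integral mphi p1 ltr01 (mollifier_eq0 mphi) iV)).
  rewrite lee_fin (le_trans _ Hrho)// ge0_ler_powR ?nnegrE ?invr_ge0 ?(ltW t0)//.
    by rewrite mulr_ge0.
  by rewrite addr_ge0 ?(ltW W0)// ltW.
clear p1.
pose d := Num.min 1 (rho / (6 * W)).
have d0 : 0 < d by rewrite lt_min ltr01 divr_gt0// mulr_gt0.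
pose D := 2 * s * (30 * k) * (k * d) `^ (s - 1).
have D0 : 0 < D.
  apply: mulr_gt0; last by rewrite powR_gt0// mulr_gt0.
  by apply: mulr_gt0; apply: mulr_gt0.
pose q := Num.min (2^-1) (rho / (2 * D)).
have q0 : 0 < q by rewrite lt_min invr_gt0 ltr0n divr_gt0// mulr_gt0.
have q2 : q <= 2^-1 by rewrite ge_min lexx.
have qD : D * q <= rho / 2.
  have : q <= rho / (2 * D) by rewrite ge_min lexx orbT.
  have DD : 0 < 2 * D by apply: mulr_gt0.
  rewrite ler_pdivlMr// => h.
  by rewrite ler_pdivlMr// (_ : D * q * 2 = q * (2 * D))//; ring.
have q02 : 0 < q <= 2^-1 by rewrite q0.
have b01 : 0 < (1 : R) <= 1 by rewrite ltr01 lexx.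
have [phi [mphi phib phiM phim]] := concentrated_mollifier q02 b01.
exists phi => //.
rewrite expr1n mulr1 mul1r in phiM phim.
pose r := 30 * k * q.
exists (k `^ s * (1 + d) `^ (s + 1) / (s + 1) + s * r * (k * d) `^ (s - 1)); split.
  have d1 : (1 + d) `^ (s + 1) <= 1 + 3 * d.
    have d1 : d <= 1 by rewrite ge_min lexx.
    apply: (@le_trans _ _ ((1 + d) `^ 2%:R)).
      by apply: ler_powR; [rewrite lerDl ltW|lra].
    by rewrite powR_mulrn; [nra|lra].
  have dW : 3 * d * W <= rho / 2.
    have : d <= rho / (6 * W) by rewrite ge_min lexx orbT.
    have WW : 0 < 6 * W by apply: mulr_gt0.
    by rewrite ler_pdivlMr//; lra.
  have kW : 2 * (k `^ s * (1 + d) `^ (s + 1) / (s + 1)) <= W * (1 + 3 * d).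
    rewrite (_ : 2 * _ = W * (1 + d) `^ (s + 1)); first by rewrite ler_wpM2l// ltW.
    by rewrite /W; field; lra.
  have -> : s * r * (k * d) `^ (s - 1) = D * q / 2 by rewrite /r /D; field.
  lra.
apply: integral_powR_le_linear => //.
move=> x; rewrite in_itv/= => /andP[x0 x1].
have M0 : 0 <= (1 + 6 * q) / pi by rewrite divr_ge0 ?(ltW p0)//; lra.
have m0 : 0 <= (1 - q) / pi by rewrite divr_ge0 ?(ltW p0)//; lra.
have := @marginal_bounds R phi _ _ 1 (1 - q) x mphi M0 m0 ltr01 phiM phib phim.
set P := marginal phi x => /andP[Pl Pu].
have x20 := sqr_ge0 x; have x21 : x ^+ 2 <= 1 by rewrite expr_le1.
have S1 : Num.sqrt (1 ^+ 2 - x ^+ 2) ^+ 2 = 1 - x ^+ 2.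
  by rewrite expr1n sqr_sqrtr// subr_ge0.
set S := Num.sqrt (1 ^+ 2 - x ^+ 2) in S1 Pu.
have U0 := sqrtr_ge0 (1 - q - x ^+ 2).
have [Ul Uu] : 1 - q - x ^+ 2 <= Num.sqrt (1 - q - x ^+ 2) ^+ 2 /\
    Num.sqrt (1 - q - x ^+ 2) ^+ 2 <= 1.
  have [u0|u0] := leP 0 (1 - q - x ^+ 2).
    by rewrite sqr_sqrtr//; split=> //; lra.
  by rewrite (ler0_sqrtr (ltW u0)) expr0n; split=> //; exact: ltW.
set U := Num.sqrt (1 - q - x ^+ 2) in U0 Ul Uu Pl.
have mU0 : 0 <= 2 * ((1 - q) / pi) * U by apply: mulr_ge0 => //; exact: mulr_ge0.
have P0 : 0 <= P := le_trans mU0 Pl.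
have Pu2 : P ^+ 2 <= k * (1 + 6 * q) ^+ 2 * (1 - x ^+ 2).
  have -> : k * (1 + 6 * q) ^+ 2 * (1 - x ^+ 2) = (2 * ((1 + 6 * q) / pi) * S) ^+ 2.
    by rewrite exprMn S1 /k; field; lra.
  by rewrite ler_pXn2r// nnegrE// (le_trans P0).
have Pl2 : k * ((1 - q) ^+ 2 * U ^+ 2) <= P ^+ 2.
  have -> : k * ((1 - q) ^+ 2 * U ^+ 2) = (2 * ((1 - q) / pi) * U) ^+ 2.
    by rewrite /k; field; lra.
  by rewrite ler_pXn2r// nnegrE.
(* Used to bound [(1 + 6 * q) ^+ 2] by [1 + 30 * q]. *)
have qq : 0 <= q * (1 / 2 - q) by rewrite mulr_ge0 ?(ltW q0)//; lra.
have h1 : (1 + 6 * q) ^+ 2 * (1 - x ^+ 2) <= 1 - x ^+ 2 + 30 * q.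
  have : 0 <= (12 * q + 36 * q ^+ 2) * x ^+ 2.
    by rewrite mulr_ge0// addr_ge0// mulr_ge0 ?sqr_ge0// ltW.
  by lra.
have h2 : 1 - x ^+ 2 - 30 * q <= (1 - q) ^+ 2 * U ^+ 2.
  have : 0 <= q * (1 - U ^+ 2) by rewrite mulr_ge0 ?(ltW q0)// subr_ge0.
  have : 0 <= q ^+ 2 * U ^+ 2 by rewrite mulr_ge0 ?sqr_ge0.
  by lra.
have h1k := ler_wpM2l (ltW k0) h1; have h2k := ler_wpM2l (ltW k0) h2.
by rewrite ler_norml /r; apply/andP; split; lra.
Qed.

(** For a mollifier in the disk of radius [b] that is bounded by a multiple of
    [b ^- 2], one has [Phi 0 <= C / b]; by [integral_powR_le_const] the constant is
    at most [D * b `^ g] with [g = 1 / tau - 3 / 2], positive when [p < 2]. *)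
Lemma Cconst_small (R : realType) (p : \bar R) (c : R) : (1 <= p)%E -> (p < 2%:E)%E ->
  0 < c -> exists2 phi, mollifier R phi & (Cconst p phi < c%:E)%E.
Proof.
move=> p1 p2 c0; have /andP[t0 t1] := tau_bounds p1.
have t23 : tau p < 2 / 3 by rewrite ltNge tau_ge23// -ltNge.
have p0 : 0 < pi :> R := pi_gt0 R.
pose s := tau p / 2; have s01 : 0 < s < 1.
  by clear p1 p2; rewrite /s; lra.
pose g := (tau p)^-1 - 3 / 2.
have g0 : 0 < g.
  by rewrite /g subr_gt0 -[3 / 2]invf_div ltf_pV2 ?posrE// divr_gt0.
pose D : R := 2 `^ (tau p)^-1 * (32 / pi ^+ 2) `^ 2^-1.
have D0 : 0 < D by rewrite mulr_gt0// powR_gt0// divr_gt0// exprn_gt0.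
pose b : R := Num.min 1 ((c / (2 * D)) `^ g^-1).
have b0 : 0 < b by rewrite lt_min ltr01 powR_gt0// divr_gt0// mulr_gt0.
have b1 : b <= 1 by rewrite ge_min lexx.
have Db : D * b `^ g < c.
  have cD : 0 < c / (2 * D) by rewrite divr_gt0// mulr_gt0.
  have : b `^ g <= c / (2 * D).
    apply: (@le_trans _ _ (((c / (2 * D)) `^ g^-1) `^ g)).
      apply: ge0_ler_powR; rewrite ?nnegrE ?powR_ge0 ?(ltW b0) ?(ltW g0)//.
      by rewrite ge_min lexx orbT.
    by rewrite -powRrM mulVf ?gt_eqF// powRr1// ltW.
  have DD : 0 < 2 * D by apply: mulr_gt0.
  by rewrite ler_pdivlMr//; clear p1 p2; lra.
have q02 : 0 < (2^-1 : R) <= 2^-1 by rewrite lexx invr_gt0 ltr0n.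
have b01 : 0 < b <= 1 by rewrite b0.
have [phi [mphi phib phiM phim]] := concentrated_mollifier q02 b01.
exists phi => //.
pose k := 32 / pi ^+ 2 / b ^+ 3.
have k0 : 0 < k by rewrite !divr_gt0// exprn_gt0.
have G0 : marginal phi 0 ^+ 2 <= 2 * b * k.
  have b20 : 0 < b ^+ 2 by rewrite exprn_gt0.
  have M0 : 0 <= (1 + 6 * 2^-1) / (pi * b ^+ 2) :> R.
    by rewrite divr_ge0 ?mulr_ge0 ?(ltW p0) ?(ltW b20)//; clear p1 p2; lra.
  have /andP[_ Gu] := marginal_bounds (m := 0) 0 mphi M0 (lexx 0) b0 phiM phib
    (d := 0) (fun z _ => mollifier_ge0 mphi z).
  have -> : 2 * b * k = (2 * ((1 + 6 * 2^-1) / (pi * b ^+ 2)) * b) ^+ 2.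
    have gen (u v : R) : 0 < u -> 0 < v -> 2 * v * (32 / u ^+ 2 / v ^+ 3) =
        (2 * ((1 + 6 * 2^-1) / (u * v ^+ 2)) * v) ^+ 2.
      by move=> u0 v0; field; rewrite (gt_eqF u0) (gt_eqF v0).
    exact: gen.
  move: Gu; rewrite expr0n subr0 sqrtr_sqr (gtr0_norm b0) => Gu.
  by rewrite ler_pXn2r// nnegrE ?marginal_ge0// mulr_ge0 ?(ltW b0)// mulr_ge0.
have := Cconst_le_integral mphi p1 b0 phib (integral_powR_le_const mphi s01 k0 b0 G0).
move=> /le_lt_trans; apply; rewrite lte_fin.
suff -> : (2 * (k `^ s * b)) `^ (tau p)^-1 = D * b `^ g by [].
have -> : k `^ s = (32 / pi ^+ 2) `^ s * b `^ (- (3 * s)).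
  rewrite /k powRM ?invr_ge0 ?exprn_ge0 ?divr_ge0 ?exprn_ge0 ?(ltW p0) ?(ltW b0)//.
  by rewrite -(powR_invn 3 (ltW b0)) -powRrM mulNr.
have bE : b `^ (- (3 * s)) * b = b `^ (1 - 3 * s).
  rewrite -[X in _ * X](powRr1 (ltW b0)) -powRD; last by rewrite (gt_eqF b0) implybT.
  by rewrite addrC.
rewrite -mulrA bE powRM ?mulr_ge0 ?powR_ge0// powRM ?powR_ge0// -!powRrM /D -mulrA.
congr (_ * (_ `^ _ * _ `^ _)); rewrite /g /s; field; rewrite gt_eqF//.
Qed.

Unset Implicit Arguments.

Theorem proposition3p5 (R : realType) (p : \bar R) (hp : (1 <= p)%E) :
  ((2%:E <= p)%E ->
     (forall phi : R * R -> R, mollifier R phi ->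
        ((2 / pi * (4 / (tau p + 2)) `^ (tau p)^-1)%:E <= Cconst p phi)%E) /\
     ereal_inf [set Cconst p phi | phi in mollifier R] =
       (2 / pi * (4 / (tau p + 2)) `^ (tau p)^-1)%:E)
  /\
  ((p < 2%:E)%E ->
     ~ exists c : R, 0 < c /\
         forall phi : R * R -> R, mollifier R phi -> (c%:E <= Cconst p phi)%E).
Proof.
have /andP[t0 t1] := tau_bounds hp.
split=> [p2|p2].
  have lb phi : mollifier R phi ->
      ((2 / pi * (4 / (tau p + 2)) `^ (tau p)^-1)%:E <= Cconst p phi)%E.
    by move=> mphi; apply: Cconst_lower => //; rewrite tau_ge23// p2.
  split=> //; apply/eqP; rewrite eq_le; apply/andP; split.
    apply/lee_addgt0Pr => e e0.
    have [phi mphi phie] := Cconst_upper hp e0.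
    by apply: le_trans phie; apply: ereal_inf_lbound; exists phi.
  by apply: le_ereal_inf_tmp => _ [phi mphi <-]; exact: lb.
move=> [c [c0 lb]]; have [phi mphi] := Cconst_small hp p2 c0.
by rewrite ltNge lb.
Qed.
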